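(* Let $k\geq 3$ be an integer, let $\lambda\in\mathbb{Q}$ and let $c_{\lambda,k}=\frac{\lambda^2}{4k}-\frac{1}{24}$. Then $$q^{c_{\lambda,k}}\sum_{\substack{n=(n_1,\dots,n_k)^{\mathrm T}\in\mathbb{N}^k\\ n_{k-1}\equiv n_k \pmod 2}}\frac{q^{n^{\mathrm T}\mathcal{C}(D_k)^{-1}n+\frac{\lambda}{2}(n_{k-1}-n_k)}}{(q;q)_{n_1}\cdots(q;q)_{n_k}}=\frac{1}{\eta(\tau)}\sum_{n\in\mathbb{Z}}q^{k\left(n+\frac{\lambda}{2k}\right)^2},$$ $$q^{c_{\lambda,k}}\sum_{\substack{n=(n_1,\dots,n_k)^{\mathrm T}\in\mathbb{N}^k\\ n_{k-1}\not\equiv n_k \pmod 2}}\frac{q^{n^{\mathrm T}\mathcal{C}(D_k)^{-1}n+\frac{\lambda}{2}(n_{k-1}-n_k)}}{(q;q)_{n_1}\cdots(q;q)_{n_k}}=\frac{1}{\eta(\tau)}\sum_{n\in\mathbb{Z}}q^{k\left(n+\frac{k-\lambda}{2k}\right)^2}.$$ Moreover, for $\lambda\in\{1,2,\dots,k-1\}$, $$q^{c_{\lambda,k}}\sum_{\substack{n=(n_1,\dots,n_k)^{\mathrm T}\in\mathbb{N}^k\\ n_{k-1}\equiv n_k \pmod 2}}\frac{q^{n^{\mathrm T}\mathcal{C}(D_k)^{-1}n+\sum_{i=k-\lambda}^{k-2}(i-k+\lambda+1)n_i+\frac{\lambda}{2}(n_{k-1}+n_k)}}{(q;q)_{n_1}\cdots(q;q)_{n_k}}=\frac{1}{\eta(\tau)}\sum_{n\in\mathbb{Z}}(2n+1)\,q^{k\left(n+\frac{\lambda}{2k}\right)^2},$$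 $$q^{c_{\lambda,k}}\sum_{\substack{n=(n_1,\dots,n_k)^{\mathrm T}\in\mathbb{N}^k\\ n_{k-1}\not\equiv n_k \pmod 2}}\frac{q^{n^{\mathrm T}\mathcal{C}(D_k)^{-1}n+\sum_{i=k-\lambda}^{k-2}(i-k+\lambda+1)n_i+\frac{\lambda}{2}(n_{k-1}+n_k)}}{(q;q)_{n_1}\cdots(q;q)_{n_k}}=\frac{2}{\eta(\tau)}\sum_{n\in\mathbb{Z}}n\,q^{k\left(n-\frac{k-\lambda}{2k}\right)^2}.$$
   Context: Here $q=e^{2\pi i\tau}$ with $\mathrm{Im}\,\tau>0$, and rational powers mean $q^{r}=e^{2\pi i r\tau}$. $\mathbb{N}=\{0,1,2,\dots\}$. For $n\in\mathbb{N}\cup\{\infty\}$, $(a;q)_n=\prod_{j=0}^{n-1}(1-aq^j)$. The Dedekind eta function is $\eta(\tau)=q^{1/24}(q;q)_\infty$. Empty sums are $0$ (e.g. $\sum_{i=k-\lambda}^{k-2}$ when $\lambda=1$). For $k\ge 3$, $\mathcal{C}(D_k)=(d_{ij})_{1\le i,j\le k}$ is the Cartan matrix of type $D_k$: $d_{ii}=2$ for $1\le i\le k$; $d_{ij}=-1$ if $|i-j|=1$ and $1\le i,j\le k-1$; $d_{k-2,k}=d_{k,k-2}=-1$; and $d_{ij}=0$ otherwise. Equivalently, $2\mathcal{C}(D_k)^{-1}=(a_{ij})_{k\times k}$ with $a_{k,k-1}=a_{k-1,k}=\frac{k}{2}-1$, $a_{k-1,k-1}=a_{k,k}=\frac{k}{2}$,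 $a_{i,k-1}=a_{i,k}=a_{k-1,i}=a_{k,i}=i$ for $1\le i\le k-2$, and $a_{ij}=2\min(i,j)$ for $1\le i,j\le k-2$. *)

(* Defs.v *)
From HB Require Import structures.
From mathcomp Require Import all_boot all_order all_algebra.
From mathcomp Require Export finmap complex.
From mathcomp Require Export all_classical all_reals all_analysis.

Set Implicit Arguments.
Unset Strict Implicit.
Unset Printing Implicit Defensive.

Import Order.TTheory GRing.Theory Num.Theory.
Import numFieldNormedType.Exports.

Local Open Scope classical_set_scope.
Local Open Scope ring_scope.
Local Open Scope complex_scope.

(* R[i]^o is R[i] with the topology of the modulus; R[i] alone carries none. *)

(* Unconditional sums: the finite partial sums converge along the directed
   family of finite sets of indices (in R[i]: absolute convergence). *)
Definition fset_net (I : choiceType) : set_system {fset I} :=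
  filter_from setT (fun A => [set B : {fset I} | (A `<=` B)%fset]).

Global Instance fset_net_filter (I : choiceType) : ProperFilter (@fset_net I).
Proof.
apply: filter_from_proper; last by move=> A _; exists A => /=; exact: fsubset_refl.
apply: filter_from_filter; first by exists fset0.
move=> A B _ _; exists (A `|` B)%fset => // C /=.
by rewrite fsubUset => /andP[].
Qed.

Section UnconditionalSum.
Variables (R : realType) (I : choiceType).

Definition partial_sum (P : pred I) (f : I -> R[i]) (B : {fset I}) : R[i]^o :=
  \sum_(i <- B | P i) f i.

Definition csummable (P : pred I) (f : I -> R[i]) : Prop :=
  cvg (partial_sum P f @ @fset_net I).

Definition csum (P : pred I) (f : I -> R[i]) : R[i] :=
  lim (partial_sum P f @ @fset_net I).

End UnconditionalSum.

Section QSeries.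
Variable R : realType.

Definition cexp (z : R[i]) : R[i] :=
  (expR (complex.Re z))%:C * (cos (complex.Im z) +i* sin (complex.Im z)).

(* q^r = exp(2 pi i r tau), for rational r; in particular q = qpow tau 1. *)
Definition qpow (tau : R[i]) (r : rat) : R[i] :=
  cexp ((0 +i* (2 * pi * ratr r)) * tau).

Definition qpoch (a q : R[i]) (n : nat) : R[i] :=
  \prod_(0 <= j < n) (1 - a * q ^+ j).

Definition qpoch_infty (a q : R[i]) : R[i] :=
  lim ((qpoch a q : nat -> R[i]^o) @ \oo).

Definition dedekind_eta (tau : R[i]) : R[i] :=
  qpow tau (1 / 24) * qpoch_infty (qpow tau 1) (qpow tau 1).

End QSeries.

Section TypeD.
Variable k : nat.

(* Here i and j run over 1, ..., k. *)
Definition cartanD_entry (i j : nat) : rat :=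
  if i == j then 2
  else if [&& (i <= k.-1)%N, (j <= k.-1)%N & (i.+1 == j) || (j.+1 == i)] then -1
  else if ((i == k.-2) && (j == k)) || ((i == k) && (j == k.-2)) then -1
  else 0.

Definition cartanD : 'M[rat]_k :=
  \matrix_(i < k, j < k) cartanD_entry i.+1 j.+1.

(* n_i for 1 <= i <= k: the component n_i sits at the ordinal i.-1. *)
Definition ncoord (n : 'cV[nat]_k) (i : nat) : nat :=
  oapp (fun j : 'I_k => n j 0) 0%N (insub i.-1).

(* n^T C(D_k)^-1 n *)
Definition quadD (n : 'cV[nat]_k) : rat :=
  let v : 'cV[rat]_k := map_mx (fun m : nat => m%:R) n in
  (v^T *m invmx cartanD *m v) 0 0.

Definition same_parity (n : 'cV[nat]_k) : bool :=
  (ncoord n k.-1 == ncoord n k %[mod 2])%N.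

Definition diff_parity (n : 'cV[nat]_k) : bool :=
  (ncoord n k.-1 != ncoord n k %[mod 2])%N.

Definition lin_diff (lam : rat) (n : 'cV[nat]_k) : rat :=
  lam / 2 * ((ncoord n k.-1)%:R - (ncoord n k)%:R).

(* The upper bound i < k.-1 is i <= k - 2. *)
Definition lin_sum (l : nat) (n : 'cV[nat]_k) : rat :=
  \sum_(k - l <= i < k.-1) (i%:R - k%:R + l%:R + 1) * (ncoord n i)%:R
  + l%:R / 2 * ((ncoord n k.-1)%:R + (ncoord n k)%:R).

Definition clam (lam : rat) : rat := lam ^+ 2 / (4 * k%:R) - 1 / 24.

Definition nahm_term (R : realType) (tau : R[i]) (lin : 'cV[nat]_k -> rat)
    (n : 'cV[nat]_k) : R[i] :=
  qpow tau (quadD n + lin n) /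
  \prod_(i < k) qpoch (qpow tau 1) (qpow tau 1) (n i 0).

(* q^(k (n + x)^2) *)
Definition theta_term (R : realType) (tau : R[i]) (x : rat) (n : int) : R[i] :=
  qpow tau (k%:R * (n%:~R + x) ^+ 2).

End TypeD.

(* Main.v *)
Require Import Defs.
From mathcomp Require Import all_boot all_order all_algebra.
From mathcomp Require Import finmap complex.
From mathcomp Require Import all_classical all_reals all_analysis.
From mathcomp Require Import zify ring lra.

Set Implicit Arguments.
Unset Strict Implicit.
Unset Printing Implicit Defensive.

Import Order.TTheory GRing.Theory Num.Theory.
Import numFieldNormedType.Exports.

Local Open Scope classical_set_scope.
Local Open Scope ring_scope.
Local Open Scope complex_scope.

(** Write the vectors in the orthonormal basis in which the simple roots of D_k
are the differences of consecutive basis vectors and the sum of the last two.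
In these coordinates n^T C^-1 n = N_1^2 + ... + N_(k-1)^2 + r^2, where
N_i = n_i + ... + n_(k-2) + (n_(k-1) + n_k) / 2 and r = (n_(k-1) - n_k) / 2,
and the second linear form is N_(k-l) + ... + N_(k-1)
([quadD_lin_diff], [quadD_lin_sum]).  The parity condition says whether the
N_i and r are all integers or all half-integers; eps = 0, 1 records this, with
N_i = m_i + eps / 2 and r = s + eps / 2.

The sum is then an iterated Bailey chain.  Put (q)_j = (q; q)_j, with
1 / (q)_j = 0 for j < 0.  The q-Vandermonde sum yields, for c >= 0,

  sum_m q^((m + c/2)^2) / ((q)_(L-m) (q)_(m-s) (q)_(m+s+c))
     = q^((s + c/2)^2) / ((q)_(L-s) (q)_(L+s+c))              ([bailey_step]).

With c = eps it removes the summation over one N_i and multiplies the summand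
by q^(r^2).  Doing this k - 1 times and truncating at N_1 <= L gives a finite
identity ([chains_sum_diff]) whose right-hand side is a sum of
q^(k r^2 + lam r) / ((q)_(L-s) (q)_(L+s+eps)).

For the second linear form, the l innermost steps carry q^(N^2 + N), which is
the step with c = eps + 1.  One passes between the two kernels by
[kern_raise]: if v(- r - 1) = q^(2r+1) v(r), then (2 r + 1) v(r) has the same sum
against 1 / ((q)_(L-s) (q)_(L+s+eps)) and 1 / ((q)_(L-s) (q)_(L+s+eps+1)),
because the difference is odd under r -> - r - 1.  The weight comes in for free
at the start since r q^(r^2) is odd ([window_theta_odd]).  This explains the
factors 2n + 1 and 2n in the last two formulas ([chains_sum_linear]).

Finally L tends to infinity.  Both sides of the finite identity are sums of a
fixed absolutely summable family against bounded weights that converge, to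
1 / (q)_oo on the left and 1 / (q)_oo^2 on the right, so a dominated
convergence argument ([tannery]) gives the theorem.  Absolute summability of
the left-hand family is itself a consequence of the finite identity, applied to
i Im tau in place of tau: there all terms are positive and dominate the absolute
values of the original ones ([nahm_bounded]). *)

(** * Inverse q-Pochhammer symbols and the q-Vandermonde sum *)

Section InversePochhammer.
Variables (F : fieldType) (q : F).
Hypothesis qX_neq1 : forall n, q ^+ n.+1 != 1.

Definition ipoch (n : nat) : F := (\prod_(j < n) (1 - q ^+ j.+1))^-1.

(** The convention 1 / (q; q)_j = 0 for j < 0 lets the summation ranges below be
described by the summands alone. *)
Definition ipochz (j : int) : F := if j is Posz n then ipoch n else 0.

Lemma ipoch0 : ipoch 0 = 1.
Proof. by rewrite /ipoch big_ord0 invr1. Qed.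

Lemma ipochS n : (1 - q ^+ n.+1) * ipoch n.+1 = ipoch n.
Proof.
rewrite /ipoch big_ord_recr /= invfM mulrCA divff ?mulr1 //.
by rewrite subr_eq0 eq_sym.
Qed.

Lemma ipoch_neq0 n : ipoch n != 0.
Proof.
by rewrite invr_eq0; apply/prodf_neq0 => j _; rewrite subr_eq0 eq_sym.
Qed.

(** Both sides satisfy
(1 - q^(n+1)) S(n+1, t) = S(n, t) + q^(n+1+t) S(n, t+1): on the sum this
comes from 1 - q^(n+1) = (1 - q^(n+1-j)) + q^(n+1-j) (1 - q^j). *)
Lemma qvandermonde n t :
  \sum_(j < n.+1) q ^+ (j ^ 2 + t * j) * (ipoch (n - j) * ipoch j * ipoch (j + t))
  = ipoch n * ipoch (n + t).
Proof.
elim: n t => [|n IHn] t.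
  by rewrite big_ord_recl big_ord0 /= muln0 expr0 ipoch0 !mul1r addr0.
have qn1 : 1 - q ^+ n.+1 != 0 by rewrite subr_eq0 eq_sym.
apply: (mulfI qn1); rewrite mulrA ipochS.
have -> : ipoch n * ipoch (n.+1 + t) = ipoch n * ipoch (n + t)
    + q ^+ (n.+1 + t) * (ipoch n * ipoch (n + t.+1)).
  by rewrite addnS addSn -[ipoch (n + t)]ipochS; ring.
rewrite -!IHn mulr_sumr.
rewrite (eq_bigr (fun j : 'I_n.+2 =>
   q ^+ (j ^ 2 + t * j) * ((1 - q ^+ (n.+1 - j)) * ipoch (n.+1 - j) * ipoch j
      * ipoch (j + t))
   + q ^+ (n.+1 - j) * (q ^+ (j ^ 2 + t * j) * (ipoch (n.+1 - j)
      * ((1 - q ^+ j) * ipoch j) * ipoch (j + t))))); last first.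
  move=> j _; rewrite -{1}(subnK (ltn_ord j : (j <= n.+1)%N)) exprD; ring.
rewrite big_split /=; congr (_ + _).
  rewrite big_ord_recr /= subnn expr0 subrr !mul0r mulr0 addr0.
  apply: eq_bigr => j _; rewrite subSn ?ipochS //.
  by rewrite -ltnS.
rewrite big_ord_recl /= expr0 subrr mul0r mulr0 mul0r !mulr0 add0r mulr_sumr.
apply: eq_bigr => j _; rewrite /bump /= add1n ipochS subSS addSnnS !mulrA.
rewrite -!exprD; congr (q ^+ _ * _ * _ * _).
have := ltn_ord j; rewrite !expnS !expn0; nia.
Qed.

Lemma ipochzS (j : int) : (1 - q ^ (j + 1)) * ipochz (j + 1) = ipochz j.
Proof.
case: j => [n|[|n]].
- have -> : Posz n + 1 = Posz n.+1 by lia.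
  exact: ipochS.
- have -> : Negz 0 + 1 = 0 by lia.
  by rewrite expr0z subrr mul0r.
- have -> : Negz n.+1 + 1 = Negz n by lia.
  by rewrite mulr0.
Qed.

(** With a = q^c this is, up to normalization, the kernel that expresses beta_L
through alpha_s in a Bailey pair relative to a, in the form symmetric under s -> - s - c. *)
Definition kern (c L : nat) (s : int) : F :=
  ipochz (L%:Z - s) * ipochz (L%:Z + s + c%:Z).

Lemma kern_sym c L s : kern c L (- s - c%:Z) = kern c L s.
Proof.
by rewrite /kern mulrC; congr (ipochz _ * ipochz _); lia.
Qed.

Lemma kernS c L s :
  kern c L s = (1 - q ^ (L%:Z + s + c%:Z + 1)) * kern c.+1 L s.
Proof.
have -> : kern c.+1 L s = ipochz (L%:Z - s) * ipochz (L%:Z + s + c%:Z + 1).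
  by congr (_ * ipochz _); lia.
by rewrite /kern -(ipochzS (L%:Z + s + c%:Z)) mulrCA.
Qed.

Lemma kern_eq0 c L s : ~~ (- L%:Z - c%:Z <= s <= L%:Z) -> kern c L s = 0.
Proof.
have ipochz_lt0 (j : int) : j < 0 -> ipochz j = 0 by case: j.
rewrite negb_and -!ltNge => /orP[] sL.
  by rewrite /kern mulrC ipochz_lt0 ?mul0r //; lia.
by rewrite /kern ipochz_lt0 ?mul0r //; lia.
Qed.

End InversePochhammer.

(** * Bailey steps and the truncated identities *)

Section BaileyStep.
Variables (F : numFieldType) (e : rat -> F).
Hypotheses (e0 : e 0 = 1) (eD : forall x y, e (x + y) = e x * e y).
Let q := e 1.
Hypothesis qX_neq1 : forall n, q ^+ n.+1 != 1.

Lemma e_nat n : e n%:R = q ^+ n.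
Proof. by elim: n => [|n IHn]; rewrite ?expr0 // exprS -IHn -eD mulrS. Qed.

Lemma e_neq0 x : e x != 0.
Proof.
apply/eqP => ex0; have := eD x (- x); rewrite subrr e0 ex0 mul0r.
by apply/eqP; rewrite oner_eq0.
Qed.

Lemma e_int (j : int) : e j%:~R = q ^ j.
Proof.
case: j => n; first exact: e_nat.
apply: (mulfI (e_neq0 n.+1%:R)); rewrite -eD NegzE.
rewrite -exprnN e_nat divff ?expf_neq0 ?e_neq0 //.
by rewrite mulrNz addrN.
Qed.

Lemma bailey_step_ge0 c L (s : nat) :
  \sum_(m < L.+1) e ((m%:R + c%:R / 2) ^+ 2) * ipoch q (L - m)
     * kern q c m s%:Z
  = e ((s%:R + c%:R / 2) ^+ 2) * kern q c L s%:Z.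
Proof.
have [ltLs|leqsL] := ltnP L s.
  rewrite kern_eq0 ?mulr0; last lia.
  by apply: big1 => m _; rewrite kern_eq0 ?mulr0 //; have := ltn_ord m; lia.
rewrite -(big_mkord xpredT (fun m => e ((m%:R + c%:R / 2) ^+ 2)
   * ipoch q (L - m) * kern q c m s%:Z)).
rewrite (@big_cat_nat _ _ _ s) //=; last by rewrite ltnW.
rewrite big_nat big1 ?add0r; last first.
  by move=> m ltms; rewrite kern_eq0 ?mulr0 //; lia.
rewrite -{1}[s]add0n big_addn big_mkord subSn //.
have -> : kern q c L s%:Z = ipoch q (L - s) * ipoch q (L - s + (s.*2 + c)).
  rewrite /kern; have -> : L%:Z - s%:Z = (L - s)%N by lia.
  by have -> : L%:Z + s%:Z + c%:Z = (L - s + (s.*2 + c))%N by lia.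
rewrite -qvandermonde // mulr_sumr; apply: eq_bigr => j _.
have -> : kern q c (j + s) s%:Z = ipoch q j * ipoch q (j + (s.*2 + c)).
  rewrite /kern; have -> : (j + s)%N%:Z - s%:Z = j by lia.
  by have -> : (j + s)%N%:Z + s%:Z + c%:Z = (j + (s.*2 + c))%N by lia.
have -> : e (((j + s)%N%:R + c%:R / 2) ^+ 2)
   = e ((s%:R + c%:R / 2) ^+ 2) * q ^+ (j ^ 2 + (s.*2 + c) * j).
  rewrite -e_nat -eD; congr e.
  by rewrite !natrD natrM natrD natrX -muln2 natrM; field.
have -> : (L - (j + s) = L - s - j)%N by lia.
ring.
Qed.

(** Completing the square makes the exponent symmetric under s -> - s - c, so that
one may take s >= 0; shifting m by s then turns the sum into [qvandermonde].  For
- c < s < 0 the identity fails in general, since some terms with m < 0 of the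
full sum do not vanish. *)
Lemma bailey_step c L (s : int) : (0 <= s) || (s <= - c%:Z) ->
  \sum_(m < L.+1) e ((m%:R + c%:R / 2) ^+ 2) * ipoch q (L - m) * kern q c m s
  = e ((s%:~R + c%:R / 2) ^+ 2) * kern q c L s.
Proof.
have [s_ge0 _|s_lt0 /= sc] := lerP 0 s.
  by case: s s_ge0 => // s _; exact: bailey_step_ge0.
have [t ht] : exists t : nat, - s - c%:Z = t.
  by exists `|- s - c%:Z|%N; lia.
rewrite -kern_sym ht; have -> : (s%:~R + c%:R / 2) ^+ 2
    = (t%:R + c%:R / 2) ^+ 2 :> rat.
  have -> : s = - t%:Z - c%:Z by lia.
  by rewrite rmorphB rmorphN /= -!pmulrn; field.
rewrite -bailey_step_ge0; apply: eq_bigr => m _.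
by rewrite -ht kern_sym.
Qed.

(** An interval that contains the support of all kernels [kern q eps L] with
L <= W and is stable under s -> - s - 1 - eps, that is, r -> - r - 1. *)
Definition window (eps : bool) (W : nat) : seq int :=
  [seq i%:Z - (W + 1 + eps)%:Z | i <- iota 0 (W.*2 + 2 + eps)].

Lemma window_uniq eps W : uniq (window eps W).
Proof. by rewrite map_inj_uniq ?iota_uniq // => i j; lia. Qed.

Lemma mem_window eps W (s : int) :
  (s \in window eps W) = (- (W + 1 + eps)%:Z <= s <= W%:Z).
Proof.
apply/mapP/idP => [[j]|hs]; first by rewrite mem_iota => hj ->; lia.
by exists `|(s + (W + 1 + eps)%:Z)%R|%N; rewrite ?mem_iota; lia.
Qed.

Lemma window_reflect (V : nmodType) (eps : bool) W (f : int -> V) :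
  \sum_(s <- window eps W) f (- s - 1 - eps%:Z) = \sum_(s <- window eps W) f s.
Proof.
rewrite -(big_map (fun s : int => - s - 1 - eps%:Z) xpredT).
apply/perm_big/uniq_perm; rewrite ?window_uniq //.
  by rewrite map_inj_uniq ?window_uniq // => s t; lia.
move=> s; apply/mapP/idP => [[t]|]; rewrite mem_window => hs.
  by move=> ->; rewrite mem_window; lia.
by exists (- s - 1 - eps%:Z); rewrite ?mem_window; lia.
Qed.

(** A pair (a, b) with a + b = 2 m + eps has s = a - m - eps, and
1 / ((q)_a (q)_b) is the kernel at (m, s). *)
Lemma kern_window (eps : bool) (m W : nat) (f : int -> F) : (m <= W)%N ->
  \sum_(a < (m.*2 + eps).+1)
     f (a%:Z - m%:Z - eps%:Z) * (ipoch q a * ipoch q (m.*2 + eps - a))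
  = \sum_(s <- window eps W) f s * kern q eps m s.
Proof.
move=> lemW; pose g (s : int) := f s * kern q eps m s.
pose r := [seq a%:Z - m%:Z - eps%:Z | a <- iota 0 (m.*2 + eps).+1].
transitivity (\sum_(s <- r) g s).
  rewrite /r big_map -[X in iota 0 X]subn0 -/(index_iota 0 _) big_mkord; apply: eq_bigr => a _.
  rewrite /g /kern mulrC [RHS]mulrC; congr (_ * _); rewrite mulrC.
  have := ltn_ord a => lta.
  have -> : m%:Z - (a%:Z - m%:Z - eps%:Z) = (m.*2 + eps - a)%N by lia.
  by have -> : m%:Z + (a%:Z - m%:Z - eps%:Z) + eps%:Z = a by lia.
rewrite [RHS](bigID (fun s : int => - m%:Z - eps%:Z <= s <= m%:Z)) /=.
rewrite [X in _ = _ + X]big1 ?addr0; last first.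
  by move=> s hs; rewrite kern_eq0 ?mulr0.
rewrite -[RHS]big_filter; apply/perm_big/uniq_perm.
- by rewrite map_inj_uniq ?iota_uniq // => i j; lia.
- by rewrite filter_uniq ?window_uniq.
move=> s; rewrite mem_filter mem_window.
apply/mapP/idP => [[a]|hs]; first by rewrite mem_iota => ha ->; lia.
by exists `|(s + m%:Z + eps%:Z)%R|%N; rewrite ?mem_iota; lia.
Qed.

Lemma window_odd_sum (eps : bool) W (f : int -> F) :
  (forall s, f (- s - 1 - eps%:Z) = - f s) -> \sum_(s <- window eps W) f s = 0.
Proof.
move=> f_odd; have /eqP : (\sum_(s <- window eps W) f s) *+ 2 = 0; last first.
  by rewrite mulrn_eq0 => /eqP.
rewrite mulr2n -{1}window_reflect -big_split /= big1 // => s _.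
by rewrite f_odd addNr.
Qed.

(** The two kernels differ by the factor 1 - q^(L+s+eps+1); the part with
q^(L+s+eps+1) is odd under the reflection of the window. *)
Lemma kern_raise (eps : bool) (L W : nat) (v : int -> F) :
  (forall s, v (- s - 1 - eps%:Z) = q ^ (2 * s + 1 + eps%:Z) * v s) ->
  \sum_(s <- window eps W) (2 * s + 1 + eps%:Z)%:~R * v s * kern q eps L s
  = \sum_(s <- window eps W) (2 * s + 1 + eps%:Z)%:~R * v s * kern q eps.+1 L s.
Proof.
move=> v_refl.
pose f s := (2 * s + 1 + eps%:Z)%:~R * (q ^ (L%:Z + s + eps%:Z + 1) * v s)
  * kern q eps.+1 L s.
rewrite -[RHS]subr0 -[X in _ = _ - X](@window_odd_sum eps W f); last first.
  move=> s; rewrite /f v_refl mulrA -expfzDr ?e_neq0 //.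
  have -> : - s - 1 - eps%:Z = - s - (eps.+1)%:Z by lia.
  rewrite kern_sym -2!mulNr -rmorphN; congr (_ %:~R * (_ ^ _ * _) * _); lia.
rewrite -sumrB; apply: eq_bigr => s _.
by rewrite /f kernS //; ring.
Qed.

(** For n = [n_1; ...; n_k] this is 2 N_1; twice the coordinate is taken to stay
in nat, and its parity is that of n_(k-1) + n_k. *)
Fixpoint dsum (n : seq nat) : nat :=
  if n is x :: n' then
    if n' is [:: y] then (x + y)%N else (x.*2 + dsum n')%N
  else 0%N.

(** The exponent of the summand.  The tail of a suffix starting at n_i has
size k - i, so that the linear term N_i is present exactly for i >= k - l;
the last two entries contribute in addition r^2 + lam r. *)
Fixpoint chain_expo (l : nat) (lam : rat) (n : seq nat) : rat :=
  if n is x :: n' then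
    let N := (dsum n)%:R / 2 in
    N ^+ 2 + (size n' <= l)%N%:R * N +
    (if n' is [:: y] then
       let r := (x%:R - y%:R) / 2 in r ^+ 2 + lam * r
     else chain_expo l lam n')
  else 0.

Definition chain_term l lam (n : seq nat) : F :=
  e (chain_expo l lam n) * \prod_(x <- n) ipoch q x.

(** All vectors of size d + 2 of parity eps with N_1 <= L + eps / 2, listed by
the values of N_1, N_2, ..., N_(k-1) and then of n_(k-1). *)
Fixpoint chains (eps : bool) (d L : nat) : seq (seq nat) :=
  if d is d'.+1 then
    [seq (M - (dsum n)./2)%N :: n | M <- iota 0 L.+1, n <- chains eps d' M]
  else
    [seq [:: a; (M.*2 + eps - a)%N] | M <- iota 0 L.+1, a <- iota 0 (M.*2 + eps).+1].

Lemma chains0E eps L : chains eps 0 L =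
  [seq [:: a; (M.*2 + eps - a)%N] | M <- iota 0 L.+1, a <- iota 0 (M.*2 + eps).+1].
Proof. by []. Qed.

Lemma chainsSE eps d L : chains eps d.+1 L =
  [seq (M - (dsum n)./2)%N :: n | M <- iota 0 L.+1, n <- chains eps d M].
Proof. by []. Qed.

Lemma dsum_cons x n : (1 < size n)%N -> dsum (x :: n) = (x.*2 + dsum n)%N.
Proof. by case: n => [|y [|z n]]. Qed.

Lemma chain_expo_cons l lam x n : (1 < size n)%N ->
  chain_expo l lam (x :: n) =
  ((dsum (x :: n))%:R / 2) ^+ 2 + (size n <= l)%N%:R * ((dsum (x :: n))%:R / 2)
  + chain_expo l lam n.
Proof. by case: n => [|y [|z n]]. Qed.

Lemma dsum_chain (eps : bool) M n : (1 < size n)%N -> odd (dsum n) = eps ->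
  ((dsum n)./2 <= M)%N -> dsum ((M - (dsum n)./2)%N :: n) = (eps + M.*2)%N.
Proof.
by move=> ? ? ?; rewrite dsum_cons //; have := odd_double_half (dsum n); lia.
Qed.

Lemma mem_chains eps d L n :
  (n \in chains eps d L) =
  [&& size n == d.+2, odd (dsum n) == eps & (dsum n)./2 <= L]%N.
Proof.
elim: d L n => [|d IHd] L n.
  rewrite chains0E; apply/allpairsPdep/idP => [[M [a [+ + ->]]]|].
    rewrite !mem_iota /= => hM ha; have -> : (a + (M.*2 + eps - a) = eps + M.*2)%N by lia.
    rewrite oddD odd_double addbF half_bit_double oddb eqxx /=; lia.
  case: n => [|a [|b [|c n]]] // /and3P[_ /eqP heps hL].
  rewrite [dsum _]/= in heps hL.
  have hab := odd_double_half (a + b); rewrite heps in hab.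
  exists ((a + b)./2), a; split; rewrite ?mem_iota; try lia.
  by congr [:: _; _]; lia.
rewrite chainsSE; apply/allpairsPdep/idP => [[M [n' [+ + ->]]]|].
  rewrite mem_iota IHd => hM /and3P[/eqP size_n' /eqP heps hn'].
  rewrite (dsum_chain _ heps) ?size_n' //=.
  by rewrite size_n' oddD odd_double addbF half_bit_double oddb !eqxx /=; lia.
case: n => [|x n'] // /and3P[/eqP[size_n']].
rewrite dsum_cons ?size_n' // oddD odd_double addFb halfD odd_double doubleK add0n.
move=> heps hL; exists (x + (dsum n')./2)%N, n'; split.
- by rewrite mem_iota; lia.
- by rewrite IHd size_n' heps eqxx /=; lia.
by congr (_ :: _); lia.
Qed.

Lemma chains_uniq eps d L : uniq (chains eps d L).
Proof.
elim: d L => [|d IHd] L.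
  rewrite chains0E; apply: allpairs_uniq_dep => [|M _|]; try exact: iota_uniq.
  move=> [M a] [M' a'] /allpairsPdep[? [? [_ + [-> ->]]]].
  move=> + /allpairsPdep[? [? [_ + [-> ->]]]].
  rewrite !mem_iota /= => h h' [ea eb]; subst.
  by congr (existT _ _ _); lia.
rewrite chainsSE; apply: allpairs_uniq_dep => [|M _|]; [exact: iota_uniq | exact: IHd |].
move=> [M n] [M' n'] /allpairsPdep[? [? [_ + [-> ->]]]].
move=> + /allpairsPdep[? [? [_ + [-> ->]]]].
rewrite !mem_chains /= => /and3P[_ _ h] /and3P[_ _ h'] [em en]; subst.
by congr (existT _ _ _); lia.
Qed.

Lemma chains_sum l lam eps d L :
  \sum_(n <- chains eps d.+1 L) chain_term l lam n * ipoch q (L - (dsum n)./2)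
  = \sum_(M < L.+1)
     e ((M%:R + eps%:R / 2) ^+ 2 + (d.+2 <= l)%N%:R * (M%:R + eps%:R / 2))
     * ipoch q (L - M)
     * \sum_(n <- chains eps d M) chain_term l lam n * ipoch q (M - (dsum n)./2).
Proof.
rewrite chainsSE big_allpairs_dep -[X in iota 0 X]subn0 -/(index_iota 0 _) big_mkord.
apply: eq_bigr => M _; rewrite mulr_sumr; apply: eq_big_seq => n.
rewrite mem_chains => /and3P[/eqP size_n /eqP heps hn].
have dn : dsum ((M - (dsum n)./2)%N :: n) = (eps + M.*2)%N.
  by apply: dsum_chain; rewrite ?size_n.
rewrite /chain_term chain_expo_cons ?size_n // dn half_bit_double.
rewrite big_cons eD.
have -> : (eps + M.*2)%:R / 2 = M%:R + eps%:R / 2 :> rat.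
  by rewrite natrD -muln2 natrM; field.
ring.
Qed.

Lemma chains0_sum l lam (eps : bool) L W : (L <= W)%N ->
  \sum_(n <- chains eps 0 L) chain_term l lam n * ipoch q (L - (dsum n)./2)
  = \sum_(M < L.+1)
     e ((M%:R + eps%:R / 2) ^+ 2 + (1 <= l)%N%:R * (M%:R + eps%:R / 2))
     * ipoch q (L - M)
     * \sum_(s <- window eps W)
         e ((s%:~R + eps%:R / 2) ^+ 2 + lam * (s%:~R + eps%:R / 2))
         * kern q eps M s.
Proof.
move=> leLW.
rewrite chains0E big_allpairs_dep -[X in iota 0 X]subn0 -/(index_iota 0 _) big_mkord.
apply: eq_bigr => M _; rewrite -kern_window; last by have := ltn_ord M; lia.
rewrite mulr_sumr -[X in iota 0 X]subn0 -/(index_iota 0 _) big_mkord.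
apply: eq_bigr => i _; move: (nat_of_ord i) (ltn_ord i) => a lta.
rewrite /chain_term /= subnKC; last by lia.
rewrite addnC half_bit_double !big_cons big_nil mulr1 eD.
have -> : (eps + M.*2)%:R / 2 = M%:R + eps%:R / 2 :> rat.
  by rewrite natrD -muln2 natrM; field.
have -> : (a%:R - (eps + M.*2 - a)%:R) / 2 =
    (a%:Z - M%:Z - eps%:Z)%:~R + eps%:R / 2 :> rat.
  rewrite !rmorphB /= -!pmulrn natrB; last by lia.
  by rewrite natrD -muln2 natrM; field.
ring.
Qed.

(** Outer steps: the plain Bailey step applied to each s. *)
Lemma window_step (eps : bool) L W (f : int -> F) :
  \sum_(M < L.+1) e ((M%:R + eps%:R / 2) ^+ 2) * ipoch q (L - M)
     * \sum_(s <- window eps W) f s * kern q eps M s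
  = \sum_(s <- window eps W) f s * e ((s%:~R + eps%:R / 2) ^+ 2) * kern q eps L s.
Proof.
under eq_bigr do rewrite mulr_sumr.
rewrite exchange_big /=; apply: eq_bigr => s _.
rewrite -mulrA -bailey_step; last by case: (eps); lia.
by rewrite mulr_sumr; apply: eq_bigr => M _; ring.
Qed.

(** Inner steps: raise the kernel, apply the Bailey step with c = eps + 1, and
lower the kernel again; the new factor q^(r^2 + r) is invariant under
r -> - r - 1, so the reflection property survives.  The only s excluded from
[bailey_step] is s = -1 for c = 2, and there the weight 2 s + 1 + eps is 0. *)
Lemma window_step_raised (eps : bool) L W (v : int -> F) :
  (forall s, v (- s - 1 - eps%:Z) = q ^ (2 * s + 1 + eps%:Z) * v s) ->
  \sum_(M < L.+1) e ((M%:R + eps%:R / 2) ^+ 2 + (M%:R + eps%:R / 2))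
     * ipoch q (L - M)
     * \sum_(s <- window eps W)
         (2 * s + 1 + eps%:Z)%:~R * v s * kern q eps M s
  = \sum_(s <- window eps W)
      (2 * s + 1 + eps%:Z)%:~R *
      (v s * e ((s%:~R + eps%:R / 2) ^+ 2 + (s%:~R + eps%:R / 2)))
      * kern q eps L s.
Proof.
move=> v_refl; rewrite kern_raise; last first.
  move=> s; rewrite v_refl -mulrA; congr (_ * (_ * e _)).
  by rewrite !rmorphB rmorphN /= -!pmulrn; field.
under eq_bigr do rewrite kern_raise // mulr_sumr.
rewrite exchange_big /=; apply: eq_bigr => s _.
(* This covers s = -1 with eps = 1, where the Bailey step does not apply. *)
have [->|s_neq] := eqVneq (2 * s + 1 + eps%:Z) 0.
  by rewrite !mul0r; apply: big1 => M _; rewrite !(mul0r, mulr0).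
(* x^2 + x = (x + 1/2)^2 - 1/4 *)
have shift (x : rat) : (x + eps%:R / 2) ^+ 2 + (x + eps%:R / 2) =
    (x + eps.+1%:R / 2) ^+ 2 + - (1 / 4).
  by rewrite -natr1; field.
transitivity ((2 * s + 1 + eps%:Z)%:~R * v s * e (- (1 / 4)) *
   (e ((s%:~R + eps.+1%:R / 2) ^+ 2) * kern q eps.+1 L s)); last first.
  by rewrite shift eD; ring.
rewrite -bailey_step; last by move: s_neq; case: (eps); lia.
by rewrite mulr_sumr; apply: eq_bigr => M _; rewrite shift eD; ring.
Qed.

Lemma chains_sum_diff lam (eps : bool) d L W : (L <= W)%N ->
  \sum_(n <- chains eps d L) chain_term 0 lam n * ipoch q (L - (dsum n)./2)
  = \sum_(s <- window eps W)
      e (d.+2%:R * (s%:~R + eps%:R / 2) ^+ 2 + lam * (s%:~R + eps%:R / 2))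
      * kern q eps L s.
Proof.
elim: d L => [|d IHd] L leLW.
  rewrite (chains0_sum _ _ _ leLW); under eq_bigr do rewrite mul0r addr0.
  rewrite window_step; apply: eq_bigr => s _.
  by rewrite -eD; congr (e _ * _); ring.
rewrite chains_sum; under eq_bigr => M _.
  by rewrite mul0r addr0 IHd; last exact: leq_trans (ltn_ord M : (M <= L)%N) leLW; over.
rewrite window_step; apply: eq_bigr => s _.
by rewrite -eD; congr (e _ * _); rewrite -[d.+3%:R]natr1; ring.
Qed.

(** The difference of the weights is 2 r, and r q^(r^2) times an even kernel is odd
under r -> - r, that is, under the exchange of n_(k-1) and n_k. *)
Lemma window_theta_odd (eps : bool) m W : (m <= W)%N ->
  \sum_(s <- window eps W) e ((s%:~R + eps%:R / 2) ^+ 2) * kern q eps m s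
  = \sum_(s <- window eps W)
     (2 * s + 1 + eps%:Z)%:~R * e ((s%:~R + eps%:R / 2) ^+ 2) * kern q eps m s.
Proof.
move=> lemW.
pose f (s : int) : F := (2 * s + eps%:Z)%:~R * e ((s%:~R + eps%:R / 2) ^+ 2).
have f_sum : \sum_(s <- window eps W) f s * kern q eps m s = 0.
  rewrite -kern_window //; set S := LHS; have /eqP : S *+ 2 = 0; last first.
    by rewrite mulrn_eq0 => /eqP.
  rewrite mulr2n {1}/S (reindex_inj rev_ord_inj) -big_split big1 //= => i _.
  move: (nat_of_ord i) (ltn_ord i) => a lta.
  have -> : ((m.*2 + eps).+1 - a.+1 = m.*2 + eps - a)%N by lia.
  have -> : (m.*2 + eps - (m.*2 + eps - a) = a)%N by lia.
  rewrite [X in X + _](_ : _ = - (f (a%:Z - m%:Z - eps%:Z) *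
     (ipoch q a * ipoch q (m.*2 + eps - a)))) ?addNr // -mulNr [ipoch q a * _]mulrC.
  congr (_ * _); rewrite /f -mulNr -rmorphN; congr (_ %:~R * e _); first by lia.
  have -> : (m.*2 + eps - a)%N%:Z = (m.*2 + eps)%N%:Z - a%:Z by lia.
  rewrite !rmorphB /= -!pmulrn natrD -muln2 natrM.
  by field.
rewrite -[LHS]addr0 -[X in _ + X = _]f_sum -big_split /=; apply: eq_bigr => s _.
by rewrite /f !rmorphD /=; ring.
Qed.

Lemma chains_sum_linear l (eps : bool) d L W : (1 <= l)%N -> (L <= W)%N ->
  \sum_(n <- chains eps d L) chain_term l 0 n * ipoch q (L - (dsum n)./2)
  = \sum_(s <- window eps W)
      (2 * s + 1 + eps%:Z)%:~R *
      e (d.+2%:R * (s%:~R + eps%:R / 2) ^+ 2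
         + (minn l d.+1)%:R * (s%:~R + eps%:R / 2))
      * kern q eps L s.
Proof.
move=> l_gt0; elim: d L => [|d IHd] L leLW.
  rewrite (chains0_sum _ _ _ leLW) l_gt0.
  under eq_bigr => M _.
    rewrite mul1r (eq_bigr (fun s => e ((s%:~R + eps%:R / 2) ^+ 2) * kern q eps M s)).
      by rewrite window_theta_odd; last exact: leq_trans (ltn_ord M : (M <= L)%N) leLW; over.
    by move=> s _; rewrite mul0r addr0.
  rewrite window_step_raised => [|s].
    apply: eq_bigr => s _; rewrite -eD; congr (_ * e _ * _).
    have -> : minn l 1 = 1%N by lia.
    by ring.
  rewrite -e_int -eD; congr e.
  by rewrite !(rmorphB, rmorphN, rmorphD, rmorphM) /= -!pmulrn; field.
rewrite chains_sum; under eq_bigr => M _.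
  by rewrite IHd; last exact: leq_trans (ltn_ord M : (M <= L)%N) leLW; over.
have [led|ltd] := leqP d.+2 l.
  under eq_bigr do rewrite mul1r.
  rewrite window_step_raised => [|s].
    apply: eq_bigr => s _; rewrite -eD; congr (_ * e _ * _).

    have -> : minn l d.+1 = d.+1 by lia.
    by rewrite -[d.+3%:R]natr1 -[d.+2%:R]natr1; ring.
  rewrite -e_int -eD; congr e.
  have -> : minn l d.+1 = d.+1 by lia.
  rewrite !(rmorphB, rmorphN, rmorphD, rmorphM) /= -!pmulrn -[d.+2%:R]natr1.
  by field.
under eq_bigr do rewrite mul0r addr0.
rewrite window_step; apply: eq_bigr => s _.
rewrite -[_ * e _ * e _]mulrA -eD; congr (_ * e _ * _).

have -> : minn l d.+1 = l by lia.
by rewrite -[d.+3%:R]natr1; ring.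
Qed.

End BaileyStep.

(** * The quadratic form of type D in orthonormal coordinates *)

Section CartanInverse.
Variable d : nat.
Let k := d.+2.

(** The rows are the simple roots of D_k, numbered from 0:
e_i - e_(i+1) for i <= d, and e_d + e_(d+1) for the last one. *)
Definition root_entry (i j : nat) : rat :=
  if (i <= d)%N then (j == i)%:R - (j == i.+1)%:R
  else (j == d)%:R + (j == d.+1)%:R.

Definition root_mx : 'M[rat]_k := \matrix_(i, j) root_entry i j.

Lemma sum_root_entry (i : nat) (f : nat -> rat) : (i < k)%N ->
  \sum_(j < k) root_entry i j * f j =
  if (i <= d)%N then f i - f i.+1 else f d + f d.+1.
Proof.
have sum_delta m : (m < k)%N -> \sum_(j < k) ((j : nat) == m)%:R * f j = f m.
  move=> ltmk; rewrite (bigD1 (Ordinal ltmk)) //= eqxx mul1r big1 ?addr0 // => j.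
  by rewrite -val_eqE /= => /negPf ->; rewrite mul0r.
move=> ltik; rewrite /root_entry; case: ifP => leid.
  under eq_bigr do rewrite mulrBl.
  by rewrite sumrB !sum_delta.
under eq_bigr do rewrite mulrDl.
by rewrite big_split /= !sum_delta.
Qed.

Lemma root_mx_gram : root_mx *m root_mx^T = cartanD k.
Proof.
apply/matrixP => i j; rewrite !mxE.
under eq_bigr do rewrite !mxE.
rewrite (sum_root_entry (root_entry j)) // /root_entry /cartanD_entry /=.
move: (nat_of_ord i) (nat_of_ord j) (ltn_ord i) (ltn_ord j) => {}i {}j.
rewrite /k => lti ltj; rewrite !eqSS !ltnS.
case: (leqP i d) => hi; case: (leqP j d) => hj.
all: do ?[case: eqP => ?; try (exfalso; lia)]; by [].
Qed.

Definition vseq (n : 'cV[nat]_k) : seq nat := [seq n i 0 | i <- enum 'I_k].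

Definition svec (s : seq nat) : 'cV[nat]_k := \col_i nth 0%N s i.

Lemma size_vseq n : size (vseq n) = k.
Proof. by rewrite size_map size_enum_ord. Qed.

Lemma nth_vseq n (i : 'I_k) : nth 0%N (vseq n) i = n i 0.
Proof. by rewrite (nth_map i) ?nth_ord_enum // size_enum_ord. Qed.

Lemma vseqK : cancel vseq svec.
Proof. by move=> n; apply/colP => i; rewrite mxE nth_vseq. Qed.

Lemma svecK s : size s = k -> vseq (svec s) = s.
Proof.
move=> size_s; apply: (@eq_from_nth _ 0%N); rewrite ?size_vseq // => i ltik.
by rewrite (nth_vseq _ (Ordinal ltik)) mxE.
Qed.

Lemma ncoordE n i : (i < k)%N -> ncoord n i.+1 = nth 0%N (vseq n) i.
Proof.
by move=> ltik; rewrite /ncoord /= insubT /= -(nth_vseq n (Ordinal ltik)).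
Qed.

(* The coordinates of n in the orthonormal basis *)
(** The solution w of root_mx *m w = n: N_1, ..., N_(k-1), and last
(n_k - n_(k-1)) / 2. *)
Definition ecoord (s : seq nat) (i : nat) : rat :=
  if (i <= d)%N then (dsum (drop i s))%:R / 2
  else ((nth 0%N s d.+1)%:R - (nth 0%N s d)%:R) / 2.

Lemma dsum_drop s i : size s = k -> (i < d)%N ->
  dsum (drop i s) = ((nth 0%N s i).*2 + dsum (drop i.+1 s))%N.
Proof.
move=> size_s ltid; rewrite (drop_nth 0%N) ?size_s; last by rewrite /k; lia.
by rewrite dsum_cons // size_drop size_s /k; lia.
Qed.

Lemma drop_last2 s : size s = k ->
  drop d s = [:: nth 0%N s d; nth 0%N s d.+1].
Proof.
move=> size_s; rewrite (drop_nth 0%N) ?size_s //.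
by rewrite (drop_nth 0%N) ?size_s // drop_oversize ?size_s.
Qed.

Lemma ecoord_root s i : size s = k -> (i < k)%N ->
  (if (i <= d)%N then ecoord s i - ecoord s i.+1
   else ecoord s d + ecoord s d.+1) = (nth 0%N s i)%:R.
Proof.
move=> size_s ltik; rewrite /ecoord leqnn ltnn; case: ltngtP => [ltid|ltdi|->].
- by rewrite dsum_drop // natrD -muln2 natrM; field.
- have -> : i = d.+1 by move: ltik ltdi; rewrite /k; lia.
  by rewrite drop_last2 //= natrD; field.
by rewrite drop_last2 //= natrD; field.
Qed.

Lemma root_mx_ecoord n :
  root_mx *m (\col_(i < k) ecoord (vseq n) i) = map_mx (fun m : nat => m%:R) n.
Proof.
apply/colP => i; rewrite !mxE; under eq_bigr do rewrite !mxE.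
by rewrite (sum_root_entry (ecoord (vseq n))) // ecoord_root ?size_vseq // nth_vseq.
Qed.

(** [root_mx_ecoord] solves the system for every right-hand side with natural
entries, in particular for the standard basis. *)
Lemma root_mx_unit : root_mx \in unitmx.
Proof.
pose n (j : 'I_k) : 'cV[nat]_k := \col_i nat_of_bool (i == j).
pose B : 'M[rat]_k := \matrix_(i, j) ecoord (vseq (n j)) i.
suff /mulmx1_unit[] : root_mx *m B = 1%:M by [].
apply/matrixP => i j.
have := congr1 (fun v : 'cV_k => v i 0) (root_mx_ecoord (n j)).
rewrite !mxE => <-; apply: eq_bigr => l _; by rewrite !mxE.
Qed.

(** The Cartan matrix is the Gram matrix A A^T of the simple roots, so
n^T (A A^T)^-1 n is the squared length of w = A^-1 n. *)
Lemma quadD_ecoord n : quadD n = \sum_(i < k) ecoord (vseq n) i ^+ 2.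
Proof.
rewrite /quadD -root_mx_gram -root_mx_ecoord; set w := \col_i _.
rewrite trmx_mul -!mulmxA.
have rU := root_mx_unit; have tU : root_mx^T \in unitmx by rewrite unitmx_tr.
have -> : invmx (root_mx *m root_mx^T) = invmx root_mx^T *m invmx root_mx.
  apply: (can_inj (mulKmx (_ : root_mx *m root_mx^T \in unitmx))).
    by rewrite unitmx_mul rU.
  rewrite mulmxV ?unitmx_mul ?rU // mulmxA -[_ *m _ *m invmx _^T]mulmxA.
  by rewrite mulmxV // mulmx1 mulmxV.
rewrite -!mulmxA mulKmx // mulKVmx // mxE; apply: eq_bigr => i _.
by rewrite !mxE expr2.
Qed.

Lemma chain_expo_ecoord l lam s : size s = k ->
  chain_expo l lam s = \sum_(i < k) ecoord s i ^+ 2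
    + \sum_(i < d.+1) (d.+1 - i <= l)%N%:R * ecoord s i
    - lam * ecoord s d.+1.
Proof.
move=> size_s.
have tail j i : (i + j)%N = d -> chain_expo l lam (drop i s) =
    \sum_(i <= m < d.+1) (ecoord s m ^+ 2 + (d.+1 - m <= l)%N%:R * ecoord s m)
    + ecoord s d.+1 ^+ 2 - lam * ecoord s d.+1.
  elim: j i => [|j IHj] i ijd.
    move: ijd; rewrite addn0 => ->.
    rewrite big_nat1 subSnn drop_last2 // /ecoord leqnn ltnn drop_last2 //=.
    by field.
  have ltid : (i < d)%N by lia.
  have drop_i : drop i s = nth 0%N s i :: drop i.+1 s.
    by rewrite (drop_nth 0%N) // size_s /k; lia.
  have size_tail : size (drop i.+1 s) = (d.+1 - i)%N by rewrite size_drop size_s.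
  rewrite drop_i chain_expo_cons ?size_tail; last by lia.
  rewrite -drop_i IHj; last by lia.
  rewrite [in RHS]big_ltn; last by lia.
  have -> : (dsum (drop i s))%:R / 2 = ecoord s i by rewrite /ecoord ltnW.
  by ring.
rewrite -[s in LHS]drop0 (tail d 0%N) // big_mkord big_split /=.
by rewrite [X in _ = X + _ - _]big_ord_recr /=; ring.
Qed.

Lemma vseq_term (F : fieldType) (q : F) (n : 'cV[nat]_k) :
  \prod_(x <- vseq n) ipoch q x = \prod_(i < k) ipoch q (n i 0).
Proof. by rewrite big_map big_enum. Qed.

Lemma dsum_parity n :
  odd (dsum (vseq n)) = odd (ncoord n k.-1 + ncoord n k).
Proof.
have size_n := size_vseq n.
have tail j i : (i + j)%N = d -> odd (dsum (drop i (vseq n))) =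
    odd (nth 0%N (vseq n) d + nth 0%N (vseq n) d.+1).
  elim: j i => [|j IHj] i ijd; first by rewrite addn0 in ijd; rewrite ijd drop_last2.
  by rewrite dsum_drop //; [rewrite oddD odd_double addFb IHj //; lia | lia].
by rewrite -[vseq n]drop0 (tail d 0%N) // !ncoordE.
Qed.

Lemma same_parityE n : same_parity n = (odd (dsum (vseq n)) == false).
Proof. by rewrite dsum_parity /same_parity !modn2 oddD; do 2!case: odd. Qed.

Lemma diff_parityE n : diff_parity n = (odd (dsum (vseq n)) == true).
Proof. by rewrite dsum_parity /diff_parity !modn2 oddD; do 2!case: odd. Qed.

Lemma quadD_lin_diff lam n :
  quadD n + lin_diff lam n = chain_expo 0 lam (vseq n).
Proof.
rewrite chain_expo_ecoord ?size_vseq // quadD_ecoord /lin_diff.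
rewrite [X in _ = _ + X - _]big1 => [|i _]; last first.
  by rewrite leqn0 subn_eq0 leqNgt ltn_ord mul0r.
by rewrite !ncoordE // /ecoord ltnn; field.
Qed.

Lemma ecoord_sum s i : size s = k -> (i <= d)%N ->
  ecoord s i = \sum_(i <= m < d) (nth 0%N s m)%:R
    + ((nth 0%N s d)%:R + (nth 0%N s d.+1)%:R) / 2.
Proof.
move=> size_s leid; have [j ijd] : exists j, (i + j)%N = d by exists (d - i)%N; lia.
elim: j i leid ijd => [|j IHj] i leid ijd.
  rewrite addn0 in ijd; rewrite ijd big_geq // /ecoord leqnn drop_last2 //=.
  by rewrite natrD add0r.
have ltid : (i < d)%N by lia.
have := ecoord_root size_s (leq_trans ltid (leqW (leqnSn d))).
rewrite leid => /eqP; rewrite subr_eq => /eqP ->.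
rewrite IHj; [|lia|lia].
by rewrite [in RHS]big_ltn // addrA.
Qed.

(** Each n_i with k - l <= i <= k - 2 occurs in N_(k-l), ..., N_i, and half of
n_(k-1) + n_k in all the l coordinates N_(k-l), ..., N_(k-1). *)
Lemma quadD_lin_sum l n : (1 <= l <= k.-1)%N ->
  quadD n + lin_sum l n = chain_expo l 0 (vseq n).
Proof.
move=> /andP[_ ltlk]; have size_n := size_vseq n.
rewrite chain_expo_ecoord // quadD_ecoord mul0r subr0; congr (_ + _).
transitivity (\sum_(d.+1 - l <= i < d.+1) ecoord (vseq n) i); last first.
  rewrite -(big_mkord xpredT (fun i => (d.+1 - i <= l)%N%:R * ecoord (vseq n) i)).
  rewrite [RHS](@big_cat_nat _ _ _ (d.+1 - l)) ?leq_subr //=.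
  rewrite [X in _ = X + _]big_nat_cond [X in _ = X + _]big1 ?add0r.
    apply: eq_big_nat => i hi; have -> : (d.+1 - i <= l)%N by lia.
    by rewrite mul1r.
  move=> i /andP[hi _]; have -> : (d.+1 - i <= l)%N = false by lia.
  by rewrite mul0r.
rewrite /lin_sum !ncoordE //; elim: l ltlk => [|l IHl] ltlk.
  by rewrite !subn0 !big_geq // mulr0n !mul0r addr0.
rewrite [RHS]big_ltn; last by lia.
have -> : (d.+1 - l.+1).+1 = (d.+1 - l)%N by lia.
rewrite -IHl; last by lia.
rewrite ecoord_sum //; last by lia.
have -> : \sum_(d.+1 - l.+1 <= m < d) (nth 0%N (vseq n) m)%:R =
    \sum_(k - l.+1 <= i < k.-1) (ncoord n i)%:R :> rat.
  have -> : (k - l.+1)%N = (d.+1 - l.+1).+1 by move: ltlk; rewrite /k /=; lia.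
  rewrite big_add1 /=; apply: eq_big_nat => i hi.
  by rewrite ncoordE //; move: hi; rewrite /k; lia.
have split_coef : \sum_(k - l.+1 <= i < k.-1)
      (i%:R - k%:R + l.+1%:R + 1) * (ncoord n i)%:R =
    \sum_(k - l.+1 <= i < k.-1) (ncoord n i)%:R +
    \sum_(k - l <= i < k.-1) (i%:R - k%:R + l%:R + 1) * (ncoord n i)%:R :> rat.
  case: l ltlk {IHl} => [|l] ltlk; first by rewrite !big_geq ?addr0 //; lia.
  have -> : (k - l.+1)%N = (k - l.+2).+1 by lia.
  have -> : \sum_((k - l.+2).+1 <= i < k.-1)
       (i%:R - k%:R + l.+1%:R + 1) * (ncoord n i)%:R =
     \sum_(k - l.+2 <= i < k.-1)
       (i%:R - k%:R + l.+1%:R + 1) * (ncoord n i)%:R :> rat.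
    rewrite [RHS]big_ltn; last by move: ltlk; rewrite /k /=; lia.
    rewrite natrB; last by move: ltlk; rewrite /k /=; lia.
    by rewrite -[l.+2%:R]natr1; ring.
  by rewrite -big_split /=; apply: eq_bigr => i _; rewrite -[l.+2%:R]natr1; ring.
by rewrite split_coef -[l.+1%:R]natr1; field.
Qed.

End CartanInverse.

(** * Unconditional sums of complex families *)

Section Unconditional.
Variables (I : choiceType) (P : pred I).

Lemma fsum_split (V : nmodType) (f : I -> V) (A : {fset I}) (s : seq I) :
  uniq s -> {subset A <= s} ->
  \sum_(i <- s | P i) f i =
  \sum_(i <- A | P i) f i + \sum_(i <- [seq j <- s | j \notin A] | P i) f i.
Proof.
move=> s_uniq subAs; rewrite -big_cat; apply/perm_big/uniq_perm => //.
  rewrite cat_uniq fset_uniq filter_uniq // andbT /=.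
  by apply/hasPn => j; rewrite mem_filter => /andP[].
move=> j; rewrite mem_cat mem_filter.
by have [/subAs ->|] := boolP (j \in A).
Qed.

Lemma real_fsum_limit_ge0 (R : realType) (a : I -> R) (K : R) :
  (forall i, 0 <= a i) ->
  (forall B : {fset I}, \sum_(i <- B | P i) a i <= K) ->
  exists S, forall eps, 0 < eps -> exists A : {fset I}, forall B : {fset I},
    (A `<=` B)%fset -> `|\sum_(i <- B | P i) a i - S| <= eps.
Proof.
move=> a_ge0 aK.
pose E := [set x : R | exists B : {fset I}, x = \sum_(i <- B | P i) a i].
have E_sup : has_sup E.
  split; first by exists (\sum_(i <- fset0 | P i) a i), fset0.
  by exists K => _ [B ->].
exists (sup E) => eps eps_gt0.
have [_ [A ->] ltA] := sup_adherent eps_gt0 E_sup.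
exists A => B /fsubsetP subAB.
have BE : \sum_(i <- B | P i) a i <= sup E.
  by apply: sup_upper_bound => //; exists B.
rewrite ler0_norm ?subr_le0 // opprB.
have AB : \sum_(i <- A | P i) a i <= \sum_(i <- B | P i) a i.
  by rewrite (fsum_split a (fset_uniq B) subAB) lerDl sumr_ge0.
lra.
Qed.

Lemma real_fsum_limit (R : realType) (a : I -> R) (K : R) :
  (forall B : {fset I}, \sum_(i <- B | P i) `|a i| <= K) ->
  exists S, forall eps, 0 < eps -> exists A : {fset I}, forall B : {fset I},
    (A `<=` B)%fset -> `|\sum_(i <- B | P i) a i - S| <= eps.
Proof.
move=> aK.
have [||S1 S1P] := @real_fsum_limit_ge0 R (fun i => `|a i|) K.
- by [].
- exact: aK.
have [||S2 S2P] := @real_fsum_limit_ge0 R (fun i => a i + `|a i|) (K + K).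
- by move=> i; have := ler_norm (- a i); rewrite normrN; lra.
- move=> B; rewrite big_split lerD // (le_trans _ (aK B)) // ler_sum // => i _.
  exact: ler_norm.
exists (S2 - S1) => eps eps_gt0.
have eps2 : 0 < eps / 2 by lra.
have [A1 A1P] := S1P _ eps2; have [A2 A2P] := S2P _ eps2.
exists (A1 `|` A2)%fset => B; rewrite fsubUset => /andP[/A1P B1 /A2P].
rewrite big_split /= => B2.
by move: B1 B2; rewrite !ler_norml => /andP[? ?] /andP[? ?]; apply/andP; split; lra.
Qed.

Variable R : realType.
Implicit Types f : I -> R[i].

Definition abs_bounded f (K : R[i]) :=
  forall B : {fset I}, \sum_(i <- B | P i) `|f i| <= K.

Lemma normc_ge_Im (z : R[i]) : `|complex.Im z|%:C <= `|z|.
Proof.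
by case: z => a b; rewrite normc_def lecR -sqrtr_sqr ler_wsqrtr // lerDr sqr_ge0.
Qed.

Lemma Re_sum f (s : seq I) :
  complex.Re (\sum_(i <- s | P i) f i) = \sum_(i <- s | P i) complex.Re (f i).
Proof. by elim/big_rec2: _ => // i x y _ <-; case: (f i) y => [? ?] []. Qed.

Lemma Im_sum f (s : seq I) :
  complex.Im (\sum_(i <- s | P i) f i) = \sum_(i <- s | P i) complex.Im (f i).
Proof. by elim/big_rec2: _ => // i x y _ <-; case: (f i) y => [? ?] []. Qed.

(** Absolutely bounded families of complex numbers have an unconditional sum: the
real and the imaginary part are differences of families of nonnegative numbers,
whose sums are suprema. *)
Lemma fsum_limit f K : abs_bounded f K ->
  exists S, forall eps, 0 < eps -> exists A : {fset I}, forall B : {fset I},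
    (A `<=` B)%fset -> `|\sum_(i <- B | P i) f i - S| <= eps.
Proof.
move=> fK.
have part_bound (g : R[i] -> R) : (forall z, `|g z|%:C <= `|z|) ->
    forall B : {fset I}, \sum_(i <- B | P i) `|g (f i)| <= complex.Re K.
  move=> g_le B; have : (\sum_(i <- B | P i) `|g (f i)|)%:C <= K.
    by rewrite rmorph_sum /= (le_trans _ (fK B)) // ler_sum.
  by rewrite lecE => /andP[].
have [Sr SrP] := real_fsum_limit (part_bound _ (@normc_ge_Re R)).
have [Si SiP] := real_fsum_limit (part_bound _ normc_ge_Im).
exists (Sr +i* Si) => eps eps_gt0.
have [e e_gt0 ->] : exists2 e : R, 0 < e & eps = e%:C.
  exists (complex.Re eps); first by move: eps_gt0; rewrite ltcE => /andP[].
  by rewrite RRe_real ?gtr0_real.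
have e2 : 0 < e / 2 by lra.
have [A1 A1P] := SrP _ e2; have [A2 A2P] := SiP _ e2.
exists (A1 `|` A2)%fset => B; rewrite fsubUset => /andP[/A1P B1 /A2P B2].
set z := _ - _.
have -> : z = (complex.Re z)%:C + 'i * (complex.Im z)%:C by rewrite -complexE.
rewrite (le_trans (ler_normD _ _)) // normrM.
have -> : `|'i%C : R[i]| = 1.
  by rewrite normc_def /= expr0n expr1n add0r sqrtr1.
rewrite mul1r.
have normC (x : R) : `|x%:C| = `|x|%:C.
  by rewrite normc_def /= expr0n addr0 sqrtr_sqr.
rewrite !normC -rmorphD lecR /z !raddfB /= Re_sum Im_sum.
by lra.
Qed.

(** The critical finite set may be taken inside P, so the estimate applies to lists
that contain no index outside P. *)
Lemma fsum_limit_seq f eps (S : R[i]) :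
  (forall eps, 0 < eps -> exists A : {fset I}, forall B : {fset I},
    (A `<=` B)%fset -> `|\sum_(i <- B | P i) f i - S| <= eps) ->
  0 < eps -> exists2 A : {fset I}, {subset A <= P} &
    forall s : seq I, uniq s -> {subset A <= s} ->
      `|\sum_(i <- s | P i) f i - S| <= eps.
Proof.
move=> + eps_gt0 => /(_ _ eps_gt0)[A AP].
exists [fset i in A | P i]%fset => [i|s s_uniq subAs].
  by rewrite !inE => /andP[].
have /AP : (A `<=` [fset i in s] `|` A)%fset by rewrite fsubsetUr.
congr (`|_ - _| <= _); rewrite -big_filter -[in RHS]big_filter.
apply/perm_big/uniq_perm; rewrite ?filter_uniq ?fset_uniq // => i.
rewrite !mem_filter !inE; have [Pi|] //= := boolP (P i).
have [//|/= /negP iNs] := boolP (i \in s).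
by apply/negbTE/negP => iA; apply: iNs; apply: subAs; rewrite !inE iA.
Qed.

Lemma csum_cvg f K : abs_bounded f K ->
  partial_sum P f @ @fset_net I --> (csum P f : R[i]^o).
Proof.
move=> /fsum_limit[S SP].
have cvgS : partial_sum P f @ @fset_net I --> (S : R[i]^o).
  apply/cvgrPdist_le => eps /SP[A AP]; exists A => // B AB.
  by rewrite distrC; apply: AP.
by rewrite /csum (cvg_lim _ cvgS).
Qed.

Lemma abs_bounded_csummable f K : abs_bounded f K -> csummable P f.
Proof. by move=> /csum_cvg fS; apply/cvg_ex; exists (csum P f). Qed.

Lemma csum_limit f K eps : abs_bounded f K -> 0 < eps ->
  exists A : {fset I}, forall B : {fset I},
    (A `<=` B)%fset -> `|\sum_(i <- B | P i) f i - csum P f| <= eps.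
Proof.
move=> /csum_cvg/cvgrPdist_le + eps_gt0 => /(_ _ eps_gt0)[A _ AP].
by exists A => B /AP; rewrite distrC.
Qed.

Lemma abs_tail f K eps : abs_bounded f K -> 0 < eps ->
  exists2 A : {fset I}, {subset A <= P} &
    forall s : seq I, uniq s -> {subset A <= s} ->
    \sum_(i <- [seq j <- s | j \notin A] | P i) `|f i| <= eps.
Proof.
move=> fK eps_gt0.
have nK : abs_bounded (fun i => `|f i|) K.
  by move=> B; rewrite (le_trans _ (fK B)) // ler_sum // => i _; rewrite normr_id.
have eps2 : 0 < eps / 2 by rewrite divr_gt0.
have [S SP] := fsum_limit nK.
have [A AP sP] := fsum_limit_seq SP eps2.
exists A => // s s_uniq subAs.
have tailE : \sum_(i <- [seq j <- s | j \notin A] | P i) `|f i| =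
    (\sum_(i <- s | P i) `|f i| - S) + (S - \sum_(i <- A | P i) `|f i|).
  by rewrite (fsum_split _ s_uniq subAs); ring.
rewrite -[leLHS]ger0_norm ?sumr_ge0 // tailE (le_trans (ler_normD _ _)) //.
by rewrite [leRHS]splitr lerD ?sP // distrC sP.
Qed.

Lemma near_forall_mem (s : seq I) (Q : nat -> I -> Prop) :
  (forall i, i \in s -> \forall L \near \oo, Q L i) ->
  \forall L \near \oo, forall i, i \in s -> Q L i.
Proof.
elim: s => [|j s IHs] sQ; first by near=> L.
have nearj := sQ j (mem_head _ _).
have nears := IHs (fun i is_ => sQ i (mem_behead (s := j :: s) is_)).
near=> L => i; rewrite inE => /orP[/eqP ->|]; first by near: L.
by move: i; near: L.
Unshelve. all: by end_near. Qed.

(** Dominated convergence.  Outside a finite set the terms contribute little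
uniformly in L, since the weights are bounded; on the finite set the weights
are eventually close to their limit. *)
Lemma tannery f K (A : nat -> seq I) (c : nat -> I -> R[i]) (l M : R[i]) :
  abs_bounded f K -> (forall L, uniq (A L)) ->
  (forall i, P i -> \forall L \near \oo, i \in A L) ->
  0 <= M -> (forall L i, `|c L i| <= M) ->
  (forall i, P i -> (c ^~ i : nat -> R[i]^o) @ \oo --> (l : R[i]^o)) ->
  (fun L => \sum_(i <- A L | P i) c L i * f i : R[i]^o) @ \oo -->
    (l * csum P f : R[i]^o).
Proof.
move=> fK A_uniq A_full M_ge0 cM c_lim; apply/cvgrPdist_le => eps eps_gt0.
have K_ge0 : 0 <= K by rewrite (le_trans _ (fK fset0)) // sumr_ge0.
pose N : R[i] := K + (M + `|l|) + `|l| + 1.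
have N_gt0 : 0 < N by rewrite ltr_wpDl // !addr_ge0.
have d_gt0 : 0 < eps / N by rewrite divr_gt0.
have [A1 A1P tail] := abs_tail fK d_gt0.
have [A2 A2P lim] := fsum_limit_seq (fun e => @csum_limit f K e fK) d_gt0.
pose A0 := (A1 `|` A2)%fset.
have A0P i : i \in A0 -> P i by rewrite !inE => /orP[/A1P|/A2P].
have near_mem : \forall L \near \oo, forall i, i \in A0 -> i \in A L.
  by apply: near_forall_mem => i /A0P; apply: A_full.
have near_lim : \forall L \near \oo, forall i, i \in A0 -> `|l - c L i| <= eps / N.
  apply: near_forall_mem => i /A0P Pi.
  by have /cvgrPdist_le := c_lim _ Pi; apply.
near=> L.
have sub0 : {subset A0 <= A L} by move=> i; move: i; near: L.
have close i : i \in A0 -> `|l - c L i| <= eps / N by move: i; near: L.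
have sub1 : {subset A1 <= A L} by move=> i iA; apply: sub0; rewrite inE iA.
have sub2 : {subset A2 <= A L} by move=> i iA; apply: sub0; rewrite inE iA orbT.
have -> : l * csum P f - \sum_(i <- A L | P i) c L i * f i =
    \sum_(i <- A L | P i) (l - c L i) * f i
    - l * (\sum_(i <- A L | P i) f i - csum P f).
  under [X in _ = X - _]eq_bigr do rewrite mulrBl.
  by rewrite sumrB -mulr_sumr; ring.
rewrite (fsum_split _ (A_uniq L) sub1).
have head_le : `|\sum_(i <- A1 | P i) (l - c L i) * f i| <= eps / N * K.
  rewrite (le_trans (ler_norm_sum _ _ _)) // (le_trans _ (ler_wpM2l (ltW d_gt0) (fK A1))) //.
  rewrite mulr_sumr big_seq_cond [leRHS]big_seq_cond ler_sum // => i /andP[iA _].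
  by rewrite normrM ler_wpM2r // close // inE iA.
have tail_le : `|\sum_(i <- [seq j <- A L | j \notin A1] | P i) (l - c L i) * f i|
    <= (M + `|l|) * (eps / N).
  rewrite (le_trans (ler_norm_sum _ _ _)) //.
  rewrite (le_trans _ (ler_wpM2l _ (tail _ (A_uniq L) sub1))) ?addr_ge0 //.
  rewrite mulr_sumr ler_sum // => i _; rewrite normrM ler_wpM2r //.
  by rewrite (le_trans (ler_normB _ _)) // addrC lerD.
have lim_le : `|l * (\sum_(i <- A L | P i) f i - csum P f)| <= `|l| * (eps / N).
  by rewrite normrM ler_wpM2l // lim.
rewrite (le_trans (ler_normB _ _)) // (le_trans (lerD (ler_normD _ _) (lexx _))) //.
rewrite (le_trans (lerD (lerD head_le tail_le) lim_le)) //.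
rewrite [eps / N * K]mulrC -!mulrDl mulrCA ler_piMr ?(ltW eps_gt0) //.
by rewrite ler_pdivrMr // mul1r /N lerDl.
Unshelve. all: by end_near. Qed.

End Unconditional.

Section Reindex.
Variables (R : realType) (I J : choiceType) (g : J -> I) (g' : I -> J).
Hypotheses (gK : cancel g g') (g'K : cancel g' g).

Lemma abs_bounded_reindex (f : I -> R[i]) K :
  abs_bounded xpredT f K -> abs_bounded xpredT (fun j => f (g j)) K.
Proof.
move=> fK B; have g_inj := can_inj gK.
rewrite -(big_map g xpredT (fun i => `|f i|)).
rewrite (perm_big [fset i in [seq g j | j <- B]]%fset) ?fK //.
apply: uniq_perm; rewrite ?map_inj_uniq ?fset_uniq // => i.
by rewrite inE.
Qed.

Lemma csum_reindex (f : I -> R[i]) K (a : R[i]) :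
  abs_bounded xpredT f K ->
  csum xpredT (fun j => a * f (g j)) = a * csum xpredT f.
Proof.
move=> fK; have g_inj := can_inj gK.
suff aS : partial_sum xpredT (fun j => a * f (g j)) @ @fset_net J -->
    (a * csum xpredT f : R[i]^o).
  by rewrite {1}/csum (cvg_lim _ aS).
apply/cvgrPdist_le => eps eps_gt0.
have d_gt0 : 0 < eps / (`|a| + 1) by rewrite divr_gt0 // ltr_wpDl.
have [A _ AP] := fsum_limit_seq (fun e => @csum_limit _ _ _ f K e fK) d_gt0.
exists [fset g' i | i in A]%fset => // B /= /fsubsetP subB.
have -> : partial_sum xpredT (fun j => a * f (g j)) B =
    a * \sum_(i <- [seq g j | j <- B]) f i.
  by rewrite big_map mulr_sumr.
rewrite -mulrBr normrM distrC.
have sB : `|\sum_(i <- [seq g j | j <- B]) f i - csum xpredT f| <= eps / (`|a| + 1).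
  apply: AP => [|i iA]; first by rewrite map_inj_uniq.
  apply/mapP; exists (g' i); rewrite ?g'K //.
  by apply: subB; apply/imfsetP; exists i.
rewrite (le_trans (ler_wpM2l _ sB)) // mulrCA ler_piMr ?(ltW eps_gt0) //.
by rewrite ler_pdivrMr ?mul1r ?lerDl // ltr_wpDl.
Qed.
End Reindex.

(** * Rational powers of q *)

Section QPow.
Variable R : realType.
Implicit Types (tau : R[i]) (x y : rat).

Lemma cexpD (z w : R[i]) : cexp (z + w) = cexp z * cexp w.
Proof.
rewrite /cexp !raddfD /= expRD cosD sinD rmorphM /=.
rewrite mulrACA; congr (_ * _).
by apply/eqP; rewrite eq_complex /= eqxx /=; apply/eqP; ring.
Qed.

Lemma qpowD tau x y : qpow tau (x + y) = qpow tau x * qpow tau y.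
Proof.
rewrite /qpow; set u := (_ +i* _); set v := (_ +i* _); set w := (_ +i* _).
suff -> : u = v + w by rewrite mulrDl cexpD.
by apply/eqP; rewrite eq_complex /= addr0 eqxx /= rmorphD mulrDr.
Qed.

Lemma qpow0 tau : qpow tau 0 = 1.
Proof.
rewrite /qpow rmorph0 mulr0 mul0r /cexp /= expR0 cos0 sin0.
by rewrite mul1r.
Qed.

Lemma norm_qpow tau x :
  `|qpow tau x| = (expR (- (2 * pi * complex.Im tau * ratr x)))%:C.
Proof.
case: tau => a b; rewrite /qpow /cexp /= !mul0r normrM !normc_def /=.
rewrite expr0n addr0 sqrtr_sqr cos2Dsin2 sqrtr1 mulr1 ger0_norm ?expR_ge0 //.
by congr (expR _)%:C; ring.
Qed.

Lemma qpow_imag (b : R) x :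
  qpow (0 +i* b) x = (expR (- (2 * pi * b * ratr x)))%:C.
Proof.
rewrite /qpow /cexp /= !mul0r mulr0 addr0 cos0 sin0 mulr1.
by rewrite sub0r; congr ((expR (- _))%:C); ring.
Qed.

Lemma norm_qpow_imag tau x : `|qpow tau x| = qpow (0 +i* complex.Im tau) x.
Proof. by rewrite norm_qpow qpow_imag. Qed.

Lemma norm_qpow1 tau : 0 < complex.Im tau ->
  exists2 x : R, 0 < x < 1 & `|qpow tau 1| = x%:C.
Proof.
move=> tau_gt0; exists (expR (- (2 * pi * complex.Im tau))); last first.
  by rewrite norm_qpow rmorph1 mulr1.
by rewrite expR_gt0 expR_lt1 oppr_lt0 !mulr_gt0 ?pi_gt0.
Qed.
End QPow.

(** * Analytic estimates for q-Pochhammer symbols and theta series *)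

Lemma geometric_sum_le (R : realType) (x : R) n : 0 <= x < 1 ->
  \sum_(j < n) x ^+ j <= (1 - x)^-1.
Proof.
move=> /andP[x_ge0 x_lt1]; have x1 : 0 < 1 - x by lra.
rewrite -[leRHS]mul1r ler_pdivlMr // mulrC.
have -> : (1 - x) * \sum_(j < n) x ^+ j = 1 - x ^+ n.
  by have := subrX1 x n; lra.
by rewrite lerBlDr lerDl exprn_ge0.
Qed.

Lemma abs_bounded_geometric (R : realType) (f : nat -> R[i]) (M x : R) :
  0 <= x < 1 -> 0 <= M -> (forall j, `|f j| <= (M * x ^+ j)%:C) ->
  abs_bounded xpredT f (M / (1 - x))%:C.
Proof.
move=> x01 M_ge0 fM B; have /andP[x_ge0 _] := x01.
pose N := (\max_(j <- B) j).+1.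
have subB : {subset B <= iota 0 N}.
  by move=> j jB; rewrite mem_iota /= add0n ltnS; apply: leq_bigmax_seq.
rewrite (le_trans (y := \sum_(j <- iota 0 N) `|f j|)) //.
  by rewrite (fsum_split xpredT _ (iota_uniq 0 N) subB) lerDl sumr_ge0.
rewrite (le_trans (y := (\sum_(j <- iota 0 N) M * x ^+ j)%:C)) //.
  by rewrite rmorph_sum /= ler_sum.
rewrite lecR -mulr_sumr ler_wpM2l //.
have -> : iota 0 N = index_iota 0 N by rewrite /index_iota subn0.
by rewrite big_mkord geometric_sum_le.
Qed.

Section PochhammerBounds.
Variable R : realType.

Lemma real_ipoch_ge1 (x : R) n : 0 < x < 1 -> 1 <= ipoch x n.
Proof.
move=> /andP[x_gt0 x_lt1].
have factor j : 0 < 1 - x ^+ j.+1 <= 1.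
  by rewrite subr_gt0 exprn_ilt1 ?(ltW x_gt0) // gerBl exprn_ge0 // ltW.
have prod_gt0 : 0 < \prod_(j < n) (1 - x ^+ j.+1).
  by apply: prodr_gt0 => j _; have /andP[] := factor j.
rewrite /ipoch invf_ge1 // prodr_ile1 // => j _.
by have /andP[/ltW -> ->] := factor j.
Qed.

(** Uniformly in n: 1 / (1 - y) = 1 + y / (1 - y) <= exp (y / (1 - y)), and the
exponents are dominated by a geometric series. *)
Lemma real_ipoch_le (x : R) n : 0 < x < 1 ->
  ipoch x n <= expR ((1 - x)^-1 * (1 - x)^-1).
Proof.
move=> x01; have /andP[x_gt0 x_lt1] := x01; have x1 : 0 < 1 - x by lra.
apply: (@le_trans _ _ (expR ((1 - x)^-1 * \sum_(j < n) x ^+ j))); last first.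
  by rewrite ler_expR ler_wpM2l ?invr_ge0 ?(ltW x1) // geometric_sum_le ?(ltW x_gt0).
rewrite mulr_sumr expR_sum /ipoch -prodfV; apply: ler_prod => j _.
have xj : x ^+ j.+1 <= x by rewrite exprS ler_piMr ?exprn_ile1 ?(ltW x_gt0) ?(ltW x_lt1).
have xj0 : 0 <= x ^+ j.+1 by rewrite exprn_ge0 // ltW.
have xjj : x ^+ j.+1 <= x ^+ j by rewrite exprS ler_piMl ?exprn_ge0 ?(ltW x_gt0) ?(ltW x_lt1).
have y1 : 0 < 1 - x ^+ j.+1 by lra.
rewrite invr_ge0 (ltW y1) /=.
apply: le_trans (expR_ge1Dx _).
have -> : (1 - x ^+ j.+1)^-1 = 1 + (1 - x ^+ j.+1)^-1 * x ^+ j.+1.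
  by field; apply: lt0r_neq0.
rewrite lerD2l ler_pM ?invr_ge0 ?(ltW y1) // lef_pV2 ?posrE //; lra.
Qed.

Variables (q : R[i]) (x : R).
Hypotheses (x01 : 0 < x < 1) (normq : `|q| = x%:C).

Lemma normqX n : `|q ^+ n| = (x ^+ n)%:C.
Proof. by rewrite normrX normq rmorphXn. Qed.

Lemma qX_neq1_of_norm n : q ^+ n.+1 != 1.
Proof.
apply/eqP => /(congr1 (fun z => `|z|)); rewrite normqX normr1 => -[] /eqP.
have /andP[x_gt0 x_lt1] := x01.
by rewrite lt_eqF // exprn_ilt1 // ltW.
Qed.

Lemma norm_ipoch_le n : `|ipoch q n| <= (ipoch x n)%:C.
Proof.
have /andP[x_gt0 x_lt1] := x01.
rewrite /ipoch -!prodfV normr_prod rmorph_prod /=; apply: ler_prod => j _.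
rewrite normr_ge0 /= normfV fmorphV lef_pV2 ?posrE.
- rewrite rmorphB rmorph1 /= -normqX.
  by rewrite lerBlDr -[leLHS]normr1 -[X in `|X| <= _](subrK (q ^+ j.+1)) ler_normD.
- by rewrite normr_gt0 subr_eq0 eq_sym qX_neq1_of_norm.
- by rewrite ltcR subr_gt0 exprn_ilt1 // ltW.
Qed.

Definition ipoch_bound : R := expR ((1 - x)^-1 * (1 - x)^-1).

Lemma norm_ipochz_le j : `|ipochz q j| <= ipoch_bound%:C.
Proof.
case: j => n /=; last by rewrite normr0 ler0c expR_ge0.
by rewrite (le_trans (norm_ipoch_le n)) // lecR real_ipoch_le.
Qed.

Lemma qpochE n : qpoch q q n = (ipoch q n)^-1.
Proof.
by rewrite /ipoch invrK /qpoch big_mkord; apply: eq_bigr => j _; rewrite exprS.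
Qed.

Lemma norm_qpoch_le n : `|qpoch q q n| <= (expR (1 - x)^-1)%:C.
Proof.
have /andP[x_gt0 x_lt1] := x01.
rewrite /qpoch big_mkord normr_prod.
rewrite (le_trans (y := \prod_(j < n) (expR (x ^+ j))%:C)) //.
  apply: ler_prod => j _; rewrite normr_ge0 /= (le_trans (ler_normB _ _)) //.
  rewrite normr1 -exprS normqX -[1 in leLHS]/(1%:C) -rmorphD lecR.
  rewrite (le_trans _ (expR_ge1Dx _)) // lerD2l exprS ler_piMl ?exprn_ge0 //; lra.
rewrite -rmorph_prod lecR -expR_sum ler_expR geometric_sum_le //; lra.
Qed.

(** The partial products telescope into the sum of their increments, which decrease
geometrically. *)
Lemma qpoch_cvg : (qpoch q q : nat -> R[i]^o) @ \oo --> (qpoch_infty q q : R[i]^o).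
Proof.
have /andP[x_gt0 x_lt1] := x01.
pose f j := qpoch q q j.+1 - qpoch q q j.
have f_bounded : abs_bounded xpredT f (expR (1 - x)^-1 / (1 - x))%:C.
  apply: abs_bounded_geometric => [||j]; rewrite ?expR_ge0 //; first by lra.
  rewrite /f /qpoch big_nat_recr //= mulrBr mulr1 addrAC subrr sub0r normrN.
  rewrite normrM rmorphM ler_pM ?norm_qpoch_le // -exprS normqX lecR.
  by rewrite exprS ler_piMl ?exprn_ge0 ?(ltW x_gt0) ?(ltW x_lt1).
have near_iota i : xpredT i -> \forall L \near \oo, i \in iota 0 L.
  by move=> _; exists i.+1 => // L /=; rewrite mem_iota.
have := tannery (c := fun _ _ => 1) (l := 1) (M := 1) f_bounded (iota_uniq 0) near_iota.
rewrite ler01 normr1 lexx => /(_ erefl (fun _ _ => erefl) (fun _ _ => cvg_cst _)).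
rewrite mul1r => f_cvg.
have poch_cvg : (qpoch q q : nat -> R[i]^o) @ \oo --> (1 + csum xpredT f : R[i]^o).
  have -> : qpoch q q = (fun L => 1 + \sum_(i <- iota 0 L) 1 * f i).
    apply/funext => L; under eq_bigr do rewrite mul1r.
    have -> : iota 0 L = index_iota 0 L by rewrite /index_iota subn0.
    rewrite telescope_sumr //; have -> : qpoch q q 0 = 1 by rewrite /qpoch big_geq.
    by rewrite addrC subrK.
  exact: (cvgD (cvg_cst (1 : R[i]^o)) f_cvg).
by rewrite /qpoch_infty (cvg_lim _ poch_cvg).
Qed.

(** The partial products are bounded away from 0 by [norm_ipochz_le]. *)
Lemma qpoch_infty_neq0 : qpoch_infty q q != 0.
Proof.
apply/eqP => P0; have /cvgrPdist_lt := qpoch_cvg; rewrite P0.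
have C_gt0 : 0 < (ipoch_bound^-1)%:C :> R[i] by rewrite ltcR invr_gt0 expR_gt0.
move=> /(_ _ C_gt0)[N _ /(_ N (leqnn N))] /=.
rewrite sub0r normrN qpochE normfV fmorphV ltf_pV2 ?posrE.
- by move=> /(le_lt_trans (norm_ipochz_le N)); rewrite ltxx.
- by rewrite normr_gt0 ipoch_neq0 // => n; apply: qX_neq1_of_norm.
by rewrite ltcR expR_gt0.
Qed.

Lemma ipochz_cvg (j : int) :
  (fun L : nat => ipochz q (L%:Z + j) : R[i]^o) @ \oo -->
    ((qpoch_infty q q)^-1 : R[i]^o).
Proof.
have ipoch_cvg : (ipoch q : nat -> R[i]^o) @ \oo --> ((qpoch_infty q q)^-1 : R[i]^o).
  have -> : ipoch q = (fun n => (qpoch q q n)^-1).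
    by apply/funext => n; rewrite qpochE invrK.
  by apply: cvgV; [exact: qpoch_infty_neq0 | exact: qpoch_cvg].
apply/cvgrPdist_le => eps eps_gt0.
have /cvgrPdist_le/(_ _ eps_gt0)[N _ NP] := ipoch_cvg.
exists (N + `|j|)%N => // L /= leL.
have -> : L%:Z + j = (`|(L%:Z + j)%R|%N : int) by lia.
by apply: NP => /=; lia.
Qed.

Lemma kern_cvg c (s : int) :
  (fun L : nat => kern q c L s : R[i]^o) @ \oo -->
    ((qpoch_infty q q)^-1 * (qpoch_infty q q)^-1 : R[i]^o).
Proof.
rewrite /kern; under eq_fun do rewrite -addrA.
by apply: cvgM; exact: ipochz_cvg.
Qed.

Lemma norm_kern_le c L s : `|kern q c L s| <= (ipoch_bound * ipoch_bound)%:C.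
Proof. by rewrite normrM rmorphM ler_pM ?norm_ipochz_le. Qed.
End PochhammerBounds.

Lemma abs_bounded_int (R : realType) (f : int -> R[i]) (K : R[i]) :
  abs_bounded xpredT (f \o Posz) K -> abs_bounded xpredT (f \o Negz) K ->
  abs_bounded xpredT f (K + K).
Proof.
move=> fK fK' B.
have [N ltN] : exists N, forall j : int, j \in B -> (`|j|%N < N)%N.
  by exists (\max_(j <- B) `|j|%N).+1 => j jB; rewrite ltnS; apply: leq_bigmax_seq.
pose s := [seq Posz j | j <- iota 0 N] ++ [seq Negz j | j <- iota 0 N].
have s_uniq : uniq s.
  rewrite cat_uniq !map_inj_uniq ?iota_uniq ?andbT /=; try by move=> ? ? [].
  by apply/hasPn => _ /mapP[i _ ->]; apply/mapP => -[].
have subB : {subset B <= s}.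
  move=> [j|j] /ltN /= ltj; rewrite mem_cat; apply/orP; [left|right];
    by apply/map_f; rewrite mem_iota /=; lia.
rewrite (le_trans (y := \sum_(j <- s) `|f j|)) //.
  by rewrite (fsum_split xpredT _ s_uniq subB) lerDl sumr_ge0.
have toB (g : nat -> int) : abs_bounded xpredT (f \o g) K ->
    \sum_(j <- [seq g j | j <- iota 0 N]) `|f j| <= K.
  move=> /(_ [fset i in iota 0 N]%fset); rewrite big_map.
  congr (_ <= _); apply/perm_big/uniq_perm; rewrite ?iota_uniq ?fset_uniq // => i.
  by rewrite inE.
by rewrite big_cat lerD // toB.
Qed.

(** Completing the square in 3 t + |b| t - a t^2. *)
Lemma gaussian_exponent_le (R : realType) (a b c t u : R) : 0 < a -> 0 <= t ->
  `|u| <= t ->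
  2 * t - (a * t ^+ 2 + b * u + c) <= (3 + `|b|) ^+ 2 / (4 * a) - c - t.
Proof.
move=> a_gt0 t_ge0 ut.
have bu : - (b * u) <= `|b| * t.
  by rewrite (le_trans (ler_norm _)) // normrN normrM ler_wpM2l.
have sq : (3 + `|b|) * t - a * t ^+ 2 <= (3 + `|b|) ^+ 2 / (4 * a).
  rewrite ler_pdivlMr; last by lra.
  have := sqr_ge0 (2 * a * t - (3 + `|b|)); lra.
lra.
Qed.

(** The weight 2 |n| + 1 <= exp (2 |n|) is absorbed in the exponent, which leaves
a geometric majorant exp (- |n|) on each half-line. *)
Lemma abs_bounded_gaussian (R : realType) (f : int -> R[i]) (a b c : R) : 0 < a ->
  (forall n : int, `|f n| <=
     ((2 * `|n%:~R| + 1) * expR (- (a * n%:~R ^+ 2 + b * n%:~R + c)))%:C) ->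
  exists K, abs_bounded xpredT f K.
Proof.
move=> a_gt0 fle; pose M := expR ((3 + `|b|) ^+ 2 / (4 * a) - c).
have x01 : 0 <= expR (- (1 : R)) < 1 by rewrite expR_ge0 expR_lt1 oppr_lt0 ltr01.
have fle' (n : int) : `|f n| <= (M * expR (- `|n%:~R|))%:C.
  rewrite (le_trans (fle n)) // lecR -expRD.
  have weight_le : 2 * `|n%:~R| + 1 <= expR (2 * `|n%:~R|) :> R.
    by rewrite addrC expR_ge1Dx.
  rewrite (le_trans (ler_wpM2r (expR_ge0 _) weight_le)) //.
  rewrite -expRD ler_expR -real_normK ?num_real //.
  by apply: gaussian_exponent_le.
exists ((M / (1 - expR (-1)))%:C + (M / (1 - expR (-1)))%:C).
have geom_le (n : int) (j : nat) : (j <= `|n|)%N ->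
    `|f n| <= (M * expR (- (1 : R)) ^+ j)%:C.
  move=> lejn; rewrite (le_trans (fle' n)) // lecR ler_wpM2l ?expR_ge0 //.
  by rewrite -expRM_natl ler_expR mulrN1 lerN2 -intr_norm -[j%:R]/(j%:~R) ler_int; lia.
apply: abs_bounded_int; apply: abs_bounded_geometric => // [|j];
  rewrite ?expR_ge0 //=; apply: geom_le; lia.
Qed.

(** * Letting the cut-off tend to infinity *)

Section NahmSum.
Variables (R : realType) (d : nat) (eps : bool) (P : pred 'cV[nat]_d.+2).
Variables (lin : 'cV[nat]_d.+2 -> rat) (l : nat) (lam : rat).
Hypothesis PE : forall n, P n = (odd (dsum (vseq n)) == eps).
Hypothesis linE : forall n, quadD n + lin n = chain_expo l lam (vseq n).

Definition chain_vecs L := [seq svec d s | s <- chains eps d L].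

Lemma chain_vecs_uniq L : uniq (chain_vecs L).
Proof.
rewrite map_inj_in_uniq ?chains_uniq // => s t.
rewrite !mem_chains => /and3P[/eqP ss _ _] /and3P[/eqP st _ _] st_eq.
by rewrite -(svecK ss) -(svecK st) st_eq.
Qed.

Lemma mem_chain_vecs L n :
  (n \in chain_vecs L) = P n && ((dsum (vseq n))./2 <= L)%N.
Proof.
apply/mapP/idP => [[s]|].
  by rewrite mem_chains => /and3P[/eqP ss hp hL] ->; rewrite PE svecK // hp.
rewrite PE => /andP[hp hL]; exists (vseq n); last by rewrite vseqK.
by rewrite mem_chains size_vseq eqxx hp.
Qed.

Lemma chain_vecs_sum (V : nmodType) (F : seq nat -> V) L :
  \sum_(n <- chain_vecs L | P n) F (vseq n) = \sum_(s <- chains eps d L) F s.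
Proof.
rewrite big_map big_seq_cond [RHS]big_seq; apply: eq_big => [s|s].
  have [|] //= := boolP (s \in chains eps d L).
  by rewrite mem_chains PE => /and3P[/eqP ss hp _]; rewrite svecK.
by rewrite mem_chains => /andP[/and3P[/eqP ss _ _] _]; rewrite svecK.
Qed.

Lemma nahm_termE (tau : R[i]) n :
  nahm_term tau lin n = chain_term (qpow tau) l lam (vseq n).
Proof.
rewrite /nahm_term /chain_term linE vseq_term -prodfV; congr (_ * _).
by apply: eq_bigr => i _; rewrite qpochE invrK.
Qed.

Lemma norm_nahm_term_le (tau : R[i]) n : 0 < complex.Im tau ->
  `|nahm_term tau lin n| <= nahm_term (0 +i* complex.Im tau) lin n.
Proof.
move=> tau_gt0; have [x x01 normq] := norm_qpow1 tau_gt0.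
rewrite !nahm_termE /chain_term normrM normr_prod norm_qpow_imag.
have q_ge0 y : 0 <= qpow (0 +i* complex.Im tau) y by rewrite -norm_qpow_imag.
rewrite ler_wpM2l //; apply: ler_prod => m _; rewrite normr_ge0 /=.
rewrite (le_trans (norm_ipoch_le x01 normq m)) //.
rewrite -norm_qpow_imag normq /ipoch fmorphV rmorph_prod.
rewrite le_eqVlt; apply/orP; left; apply/eqP; congr (_^-1).
by apply: eq_bigr => j _; rewrite rmorphB rmorphXn rmorph1.
Qed.

Variable Phi : R[i] -> int -> R[i].
Hypothesis finite_identity : forall (tau : R[i]) L, 0 < complex.Im tau ->
  \sum_(n <- chains eps d L)
     chain_term (qpow tau) l lam n * ipoch (qpow tau 1) (L - (dsum n)./2)
  = \sum_(s <- window eps L) Phi tau s * kern (qpow tau 1) eps L s.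
Hypothesis Phi_bounded : forall tau : R[i], 0 < complex.Im tau ->
  exists K, abs_bounded xpredT (Phi tau) K.

(** At i Im tau all quantities are positive and 1 / (q)_j >= 1.  Hence a finite sum
of absolute values is at most the left-hand side of the finite identity at
i Im tau for L large, and the right-hand side is bounded independently of L. *)
Lemma nahm_bounded (tau : R[i]) : 0 < complex.Im tau ->
  exists K, abs_bounded P (nahm_term tau lin) K.
Proof.
move=> tau_gt0; pose t : R[i] := 0 +i* complex.Im tau.
have t_gt0 : 0 < complex.Im t by [].
have [K PhiK] := Phi_bounded t_gt0; have [x x01 normq] := norm_qpow1 t_gt0.
have q_ge0 y : 0 <= qpow t y by rewrite -(norm_qpow_imag tau).
have qE : qpow t 1 = x%:C by rewrite -normq ger0_norm.
have ipochE m : ipoch (qpow t 1) m = (ipoch x m)%:C.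
  rewrite qE /ipoch fmorphV rmorph_prod; congr (_^-1).
  by apply: eq_bigr => j _; rewrite rmorphB rmorphXn rmorph1.
have ipoch_ge1 m : 1 <= ipoch (qpow t 1) m by rewrite ipochE lecR real_ipoch_ge1.
have term_ge0 s : 0 <= chain_term (qpow t) l lam s.
  rewrite mulr_ge0 // prodr_ge0 // => m _.
  exact: le_trans ler01 (ipoch_ge1 m).
pose M := (ipoch_bound x * ipoch_bound x)%:C.
exists (M * K) => B.
pose B' := [fset n in B | P n]%fset.
rewrite big_fset_condE -/B'.
have B'P n : n \in B' -> P n by rewrite !inE => /andP[].
have [L subL] : exists L, {subset B' <= chain_vecs L}.
  exists (\max_(n <- B') (dsum (vseq n))./2) => n nB'.
  by rewrite mem_chain_vecs B'P //=; apply: leq_bigmax_seq.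
rewrite (le_trans (y := \sum_(n <- B' | P n) chain_term (qpow t) l lam (vseq n))) //.
  rewrite [leRHS]big_mkcond !big_seq ler_sum // => n /B'P ->.
  by rewrite -nahm_termE norm_nahm_term_le.
rewrite (le_trans (y := \sum_(n <- chain_vecs L | P n) chain_term (qpow t) l lam (vseq n))) //.
  by rewrite (fsum_split P _ (chain_vecs_uniq L) subL) lerDl sumr_ge0.
rewrite (chain_vecs_sum (chain_term (qpow t) l lam)).
rewrite (le_trans (y := \sum_(n <- chains eps d L)
     chain_term (qpow t) l lam n * ipoch (qpow t 1) (L - (dsum n)./2))) //.
  by rewrite ler_sum // => n _; rewrite ler_peMr.
rewrite finite_identity //.
have sum_ge0 : 0 <= \sum_(s <- window eps L) Phi t s * kern (qpow t 1) eps L s.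
  rewrite -finite_identity // sumr_ge0 // => n _.
  by rewrite mulr_ge0 // (le_trans ler01 (ipoch_ge1 _)).
rewrite -[leLHS]ger0_norm // (le_trans (ler_norm_sum _ _ _)) //.
rewrite (le_trans (y := \sum_(s <- window eps L) M * `|Phi t s|)) //.
  rewrite ler_sum // => s _; rewrite normrM mulrC ler_wpM2r //.
  exact: norm_kern_le x01 normq _ _ _.
rewrite -mulr_sumr ler_wpM2l ?ler0c ?mulr_ge0 ?expR_ge0 //.
rewrite (le_trans _ (PhiK [fset s in window eps L]%fset)) //.
rewrite le_eqVlt; apply/orP; left; apply/eqP/perm_big/uniq_perm => [||s].
- exact: window_uniq.
- exact: fset_uniq.
by rewrite inE.
Qed.

(** In the limit L -> oo the finite identity reads
S / (q)_oo = T / (q)_oo^2, with S and T the two unconditional sums. *)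
Lemma nahm_csum (tau : R[i]) : 0 < complex.Im tau ->
  csum P (nahm_term tau lin) =
  (qpoch_infty (qpow tau 1) (qpow tau 1))^-1 * csum xpredT (Phi tau).
Proof.
move=> tau_gt0; have [K nK] := nahm_bounded tau_gt0.
have [K' PhiK] := Phi_bounded tau_gt0.
have [x x01 normq] := norm_qpow1 tau_gt0.
set q := qpow tau 1 in normq *; set Q := qpoch_infty q q.
have Q_neq0 : Q != 0 := qpoch_infty_neq0 x01 normq.
have B_ge0 : 0 <= (ipoch_bound x)%:C :> R[i] by rewrite ler0c expR_ge0.
have BB_ge0 : 0 <= (ipoch_bound x * ipoch_bound x)%:C :> R[i].
  by rewrite ler0c mulr_ge0 ?expR_ge0.
have vecs_cvg n : P n -> \forall L \near \oo, n \in chain_vecs L.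
  by move=> Pn; exists (dsum (vseq n))./2 => // L /=; rewrite mem_chain_vecs Pn.
have window_cvg (s : int) : xpredT s -> \forall L \near \oo, s \in window eps L.
  by move=> _; exists `|s|%N => // L /=; rewrite mem_window; lia.
have lhs_cvg := tannery (c := fun L n => ipochz q (L%:Z - ((dsum (vseq n))./2)%:Z))
  nK chain_vecs_uniq vecs_cvg B_ge0 (fun L n => norm_ipochz_le x01 normq _)
  (fun n _ => ipochz_cvg x01 normq _).
have rhs_cvg := tannery (c := fun L s => kern q eps L s)
  PhiK (window_uniq eps) window_cvg BB_ge0
  (fun L s => norm_kern_le x01 normq eps L s)
  (fun s _ => kern_cvg x01 normq eps s).
have sums_eq : (fun L => \sum_(n <- chain_vecs L | P n)
      ipochz q (L%:Z - ((dsum (vseq n))./2)%:Z) * nahm_term tau lin n) =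
    (fun L => \sum_(s <- window eps L) kern q eps L s * Phi tau s).
  apply/funext => L; under [RHS]eq_bigr do rewrite mulrC.
  rewrite -finite_identity //.
  under eq_bigr do rewrite nahm_termE.
  rewrite (chain_vecs_sum (fun s => ipochz q (L%:Z - ((dsum s)./2)%:Z)
    * chain_term (qpow tau) l lam s)).
  apply: eq_big_seq => s; rewrite mem_chains => /and3P[_ _ leL].
  by rewrite mulrC subzn.
rewrite sums_eq in lhs_cvg.
have lim_eq : Q^-1 * csum P (nahm_term tau lin) =
    Q^-1 * Q^-1 * csum xpredT (Phi tau).
  exact: (@norm_cvg_unique _ R[i]^o _ _ _ _ lhs_cvg rhs_cvg).
by apply: (mulfI (invr_neq0 Q_neq0)); rewrite mulrA.
Qed.
End NahmSum.

Lemma abs_bounded_theta (R : realType) (k : nat) (tau : R[i]) (x : rat) (w : int -> int) :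
  (0 < k)%N -> 0 < complex.Im tau -> (forall n, `|w n| <= 2 * `|n| + 1) ->
  exists K, abs_bounded xpredT (fun n => (w n)%:~R * theta_term k tau x n) K.
Proof.
move=> k_gt0 tau_gt0 w_le; pose h : R := 2 * pi * complex.Im tau.
have h_gt0 : 0 < h by rewrite !mulr_gt0 ?pi_gt0.
apply: (@abs_bounded_gaussian _ _ (h * k%:R) (2 * (h * k%:R * ratr x))
  (h * k%:R * ratr x ^+ 2)) => [|n]; first by rewrite mulr_gt0 ?ltr0n.
have wn_le : `|(w n)%:~R : R[i]| <= (2 * `|n%:~R| + 1)%:C.
  have -> : (w n)%:~R = ((w n)%:~R : R)%:C :> R[i] by rewrite rmorph_int.
  rewrite normc_def /= expr0n addr0 sqrtr_sqr lecR.
  rewrite -!intr_norm -[2 in leRHS]/(2%:~R) -intrM -[1 in leRHS]/(1%:~R) -intrD.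
  by rewrite ler_int.
have mulC (y z : R) : (y * z)%:C = y%:C * z%:C by rewrite rmorphM.
rewrite normrM norm_qpow -/h mulC.
apply: ler_pM => //; rewrite ?lecR ?expR_ge0 // ler_expR lerN2 !(rmorphM, rmorphXn, rmorphD) /= ratr_nat ratr_int.
by rewrite le_eqVlt; apply/orP; left; apply/eqP; ring.
Qed.

(** The common end of the four identities: Phi is matched with the theta series of
the statement by the bijection g of the summation indices, up to the factor
m q^(- mu^2 / (4 k)) left over from completing the square. *)
Lemma nahm_theta (R : realType) (d : nat) (eps : bool) (P : pred 'cV[nat]_d.+2)
    (lin : 'cV[nat]_d.+2 -> rat) (l : nat) (lam mu x : rat) (m : R[i])
    (w g g' : int -> int) (Phi : R[i] -> int -> R[i]) (tau : R[i]) :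
  (forall n, P n = (odd (dsum (vseq n)) == eps)) ->
  (forall n, quadD n + lin n = chain_expo l lam (vseq n)) ->
  (forall (t : R[i]) L, 0 < complex.Im t ->
    \sum_(n <- chains eps d L)
       chain_term (qpow t) l lam n * ipoch (qpow t 1) (L - (dsum n)./2)
    = \sum_(s <- window eps L) Phi t s * kern (qpow t 1) eps L s) ->
  cancel g g' -> cancel g' g -> (forall n, `|w n| <= 2 * `|n| + 1) ->
  (forall t s, Phi t s = m * qpow t (- (mu ^+ 2 / (4 * d.+2%:R)))
     * ((w (g s))%:~R * theta_term d.+2 t x (g s))) ->
  0 < complex.Im tau ->
  [/\ csummable P (nahm_term tau lin),
      csummable xpredT (fun n => (w n)%:~R * theta_term d.+2 tau x n) &
      qpow tau (clam d.+2 mu) * csum P (nahm_term tau lin)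
      = m / dedekind_eta tau *
        csum xpredT (fun n => (w n)%:~R * theta_term d.+2 tau x n)].
Proof.
move=> PE linE fin gK g'K w_le PhiE tau_gt0.
have theta_bounded t := @abs_bounded_theta R d.+2 t x w isT ^~ w_le.
have Phi_bounded (t : R[i]) : 0 < complex.Im t -> exists K, abs_bounded xpredT (Phi t) K.
  move=> /theta_bounded[K thetaK].
  pose a := m * qpow t (- (mu ^+ 2 / (4 * d.+2%:R))).
  exists (`|a| * K) => B; under eq_bigr do rewrite PhiE normrM.
  by rewrite -mulr_sumr ler_wpM2l // (abs_bounded_reindex gK thetaK).
have [K nahmK] := nahm_bounded PE linE fin Phi_bounded tau_gt0.
have [K' thetaK] := theta_bounded _ tau_gt0.
split; first exact: abs_bounded_csummable nahmK.
  exact: abs_bounded_csummable thetaK.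
have [y y01 normq] := norm_qpow1 tau_gt0.
have Q_neq0 := qpoch_infty_neq0 y01 normq.
rewrite (nahm_csum PE linE fin Phi_bounded tau_gt0).
have -> : Phi tau = fun s => m * qpow tau (- (mu ^+ 2 / (4 * d.+2%:R)))
    * ((w (g s))%:~R * theta_term d.+2 tau x (g s)) by apply/funext => s.
rewrite (csum_reindex gK g'K _ thetaK).
have e_neq0 z : qpow tau z != 0 := e_neq0 (qpow0 tau) (qpowD tau) z.
have clamE : qpow tau (clam d.+2 mu) * qpow tau (- (mu ^+ 2 / (4 * d.+2%:R)))
    = (qpow tau (1 / 24))^-1.
  apply: (mulIf (e_neq0 (1 / 24))); rewrite mulVf // -!qpowD /clam.
  rewrite -(qpow0 tau); congr qpow; ring.
rewrite /dedekind_eta [(qpow _ _ * _)^-1]invfM -clamE.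
ring.
Qed.

Lemma theta_exponent (k : nat) (lam rho : rat) : (0 < k)%N ->
  k%:R * rho ^+ 2 + lam * rho =
  - (lam ^+ 2 / (4 * k%:R)) + k%:R * (rho + lam / (2 * k%:R)) ^+ 2.
Proof. by move=> k_gt0; field; rewrite pnatr_eq0 -lt0n. Qed.

Theorem theorem1p1 (R : realType) (k : nat) (tau : R[i]) :
  (3 <= k)%N -> 0 < complex.Im tau ->
  (forall lam : rat,
    [/\ csummable (@same_parity k) (nahm_term tau (lin_diff lam)),
        csummable xpredT (theta_term k tau (lam / (2 * k%:R))) &
        qpow tau (clam k lam) *
          csum (@same_parity k) (nahm_term tau (lin_diff lam))
        = 1 / dedekind_eta tau *
          csum xpredT (theta_term k tau (lam / (2 * k%:R)))] /\
    [/\ csummable (@diff_parity k) (nahm_term tau (lin_diff lam)),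
        csummable xpredT (theta_term k tau ((k%:R - lam) / (2 * k%:R))) &
        qpow tau (clam k lam) *
          csum (@diff_parity k) (nahm_term tau (lin_diff lam))
        = 1 / dedekind_eta tau *
          csum xpredT (theta_term k tau ((k%:R - lam) / (2 * k%:R)))]) /\
  (forall l : nat, (1 <= l <= k.-1)%N ->
    [/\ csummable (@same_parity k) (nahm_term tau (lin_sum l)),
        csummable xpredT (fun n : int =>
          (2 * n + 1)%:~R * theta_term k tau (l%:R / (2 * k%:R)) n) &
        qpow tau (clam k l%:R) *
          csum (@same_parity k) (nahm_term tau (lin_sum l))
        = 1 / dedekind_eta tau *
          csum xpredT (fun n : int =>
            (2 * n + 1)%:~R * theta_term k tau (l%:R / (2 * k%:R)) n)] /\
    [/\ csummable (@diff_parity k) (nahm_term tau (lin_sum l)),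
        csummable xpredT (fun n : int =>
          n%:~R * theta_term k tau (- ((k%:R - l%:R) / (2 * k%:R))) n) &
        qpow tau (clam k l%:R) *
          csum (@diff_parity k) (nahm_term tau (lin_sum l))
        = 2 / dedekind_eta tau *
          csum xpredT (fun n : int =>
            n%:~R * theta_term k tau (- ((k%:R - l%:R) / (2 * k%:R))) n)]).
Proof.
case: k => [|[|d]] // _ tau_gt0.
have d2_neq0 : d.+2%:R != 0 :> rat by rewrite pnatr_eq0.
have qX_neq1 (t : R[i]) : 0 < complex.Im t -> forall n, qpow t 1 ^+ n.+1 != 1.
  by move=> /norm_qpow1[x x01 normq] n; apply: qX_neq1_of_norm x01 normq n.
split=> [lam|l lk].
- have fin eps (t : R[i]) L : 0 < complex.Im t -> _ := fun t_gt0 =>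
    chains_sum_diff (qpow0 t) (qpowD t) (qX_neq1 t t_gt0) lam eps d (leqnn L).
  have one_le (n : int) : `|1 : int| <= 2 * `|n| + 1 by lia.
  have theta1 x : theta_term d.+2 tau x = fun n => (1 : int)%:~R * theta_term d.+2 tau x n.
    by apply/funext => n; rewrite mul1r.
  rewrite (theta1 (lam / (2 * d.+2%:R))) (theta1 ((d.+2%:R - lam) / (2 * d.+2%:R))); split.
    apply: (nahm_theta (@same_parityE d) (quadD_lin_diff lam) (fin false)
      (fun=> erefl) (fun=> erefl) one_le) => // t s.
    by rewrite !mul1r /theta_term -qpowD mul0r addr0 theta_exponent.
  (* r = s + 1/2 corresponds to n = - s - 1, and the square is even. *)
  pose g (s : int) := - s - 1.
  have gK : cancel g g by move=> s; rewrite /g; lia.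
  apply: (nahm_theta (@diff_parityE d) (quadD_lin_diff lam) (fin true) gK gK
      one_le) => // t s.
  rewrite !mul1r /theta_term -qpowD theta_exponent //; congr (qpow _ (_ + _ * _)).
  rewrite /g rmorphB rmorphN rmorph1 /=.
  by field.
have /andP[l_gt0 ltlk] := lk; rewrite /= in ltlk.
have fin eps (t : R[i]) L : 0 < complex.Im t -> _ := fun t_gt0 =>
  chains_sum_linear (qpow0 t) (qpowD t) (qX_neq1 t t_gt0) eps d l_gt0 (leqnn L).
have linE := fun n : 'cV[nat]_d.+2 => quadD_lin_sum n lk.
have min_l : minn l d.+1 = l by apply/minn_idPl.
split.
  have w_le (n : int) : `|2 * n + 1| <= 2 * `|n| + 1 by lia.
  apply: (nahm_theta (@same_parityE d) linE (fin false)
      (fun=> erefl) (fun=> erefl) w_le) => // t s.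
  rewrite mul1r /theta_term [RHS]mulrCA -qpowD mul0r !addr0 min_l.
  by rewrite theta_exponent.
have w_le (n : int) : `|n| <= 2 * `|n| + 1 by lia.
(* r = s + 1/2 = n - 1/2 with n = s + 1, so that 2 r + 1 = 2 n. *)
pose g (s : int) := s + 1; pose g' (s : int) := s - 1.
have gK : cancel g g' by move=> s; rewrite /g /g'; lia.
have g'K : cancel g' g by move=> s; rewrite /g /g'; lia.
apply: (nahm_theta (@diff_parityE d) linE (fin true) gK g'K w_le) => // t s.
rewrite /theta_term [RHS]mulrACA -qpowD theta_exponent // min_l.
have -> : 2 * s + 1 + true = 2 * g s by rewrite /g; lia.
rewrite intrM; congr (_ * qpow _ (_ + _ * _)).
by rewrite /g rmorphD /=; field.
Qed.
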